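(* Let $K$ be a quasi-metric kernel on $X$, $\sigma\in\mathcal M_+(X)$, $1<q<\infty$, $\frac1p+\frac1q=1$. Consider the condition ( * ) there is a constant $C$ such that for all $x\in X$ and $a>0$, $$\int_0^a\frac{|B_t(x)|_\sigma}{t^2}\,dt\le C\,a^{q-1}\int_a^\infty\frac{|B_t(x)|_\sigma}{t^{1+q}}\,dt .$$ (1) Suppose there is a nonzero measure $\mu$ which is stable with respect to $K$ and absolutely continuous with respect to $\sigma$. If $\mathcal Y_{p,K}=\mathcal Z_{q,K}\ne\{0\}$, then ( * ) holds. (2) Suppose that $K$ is continuous, that each ball $B_a(x)$ is compact, and that there is a nonzero measure $\mu$ which is stable with respect to $K$. If $K\omega\in\mathcal Z_{q,K}$ for every measure $\omega\in\widetilde{\mathcal W}_{p,K}$, then ( * ) holds.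
   Context: $X$ is a metric space and $\mathcal M_+(X)$ is the set of positive $\sigma$-finite Borel measures on $X$; $\sigma$ is the underlying measure. $|E|_\mu=\mu(E)$. $L^0_+(\sigma)$ is the set of ($\sigma$-a.e. classes of) Borel functions $X\to[0,\infty)$. A quasi-metric kernel is a Borel function $K:X\times X\to(0,\infty]$ that is symmetric and for which there is a constant $\kappa\ge1$ with $\frac1{K(x,y)}\le\kappa\big(\frac1{K(x,z)}+\frac1{K(z,y)}\big)$ for all $x,y,z\in X$. Put $\rho(x,y)=1/K(x,y)$ and $B_a(x)=\{y\in X:\rho(x,y)\le a\}$. ''$K$ continuous'' means continuous as a map into $(0,\infty]$, i.e. $\rho$ is continuous. For $\mu\in\mathcal M_+(X)$, $K\mu(x)=\int K(x,y)\,d\mu(y)$; for Borel $f\ge0$, $Kf(x)=\int K(x,y)f(y)\,d\sigma(y)$. $\mathcal Z_{q,K}$ is the set of measurable $f$ for which there is $\epsilon>0$ such that $u=Ku^q+\epsilon|f|$ $\sigma$-a.e. has a solution $u\in L^0_+(\sigma)$. $\mathcal Y_{p,K}$ is the set of real-valued measurable $f$ such that for some $C$, $\int|f|^q(Kg)^p\,d\sigma\le C\int g^p\,d\sigma$ for all $0\le g\in L^p(\sigma)$. $\widetilde{\mathcal W}_{p,K}$ is the set of $\omega\in\mathcal M_+(X)$ such that for some $C$, $\int(Kg)^p\,d\omega\le C\int g^p\,d\sigma$ for all $0\le g\in L^p(\sigma)$. A Borel measure is locally finite if it is finite on every Borel set $B$ with $\sup_{x,y\in B}\rho(x,y)<\infty$.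 A locally finite Borel measure $\mu$ is stable with respect to $K$ if there are $C>0$, $\delta>0$ such that for every $x\in X$ and $0<r<R<\infty$: $|B_{2R}(x)|_\mu\le C|B_R(x)|_\mu$ and $|B_r(x)|_\mu\le C(r/R)^{1+\delta}|B_R(x)|_\mu$. *)

(* Defs.v *)
From HB Require Import structures.
From mathcomp Require Import all_boot all_order all_algebra.
From mathcomp Require Import all_classical all_reals all_analysis.
From mathcomp Require Import measurable_realfun.

Set Implicit Arguments.
Unset Strict Implicit.
Unset Printing Implicit Defensive.

Import Order.TTheory GRing.Theory Num.Theory.
Import numFieldNormedType.Exports.

Local Open Scope classical_set_scope.
Local Open Scope ring_scope.
Local Open Scope ereal_scope.

(* Measurable types are pointed in MathComp-Analysis, so the underlying metric
   space comes with a base point, which is otherwise never used. *)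
#[short(type="pmetricType")]
HB.structure Definition PointedMetric (R : numDomainType) :=
  { M of Metric R M & Pointed M }.

(* [T] with its Borel sigma-algebra *)
Notation borel T := (g_sigma_algebraType (@open T)).

Section kernel.
Context {R : realType} {X : pmetricType R}.
Implicit Types (K : X -> X -> \bar R) (x y z : X).

Definition qrho K x y : \bar R := (K x y)^-1.

Definition qball K x (a : R) : set X := [set y | qrho K x y <= a%:E].

(* The kernel is Borel on the topological product [X * X]; for nonseparable [X]
   this can be weaker than measurability for the product of the Borel
   sigma-algebras. *)
Record quasi_metric_kernel K : Prop := QuasiMetricKernel {
  qmk_borel : measurable_fun [set: borel (X * X)%type]
                (fun z : X * X => K z.1 z.2) ;
  qmk_gt0 : forall x y, 0 < K x y ;
  qmk_sym : forall x y, K x y = K y x ;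
  qmk_quasi : exists2 kappa : R, (1 <= kappa)%R &
    forall x y z, qrho K x y <= kappa%:E * (qrho K x z + qrho K z y) }.

Definition continuous_kernel K := continuous (fun z : X * X => K z.1 z.2).

Definition pot_measure K (mu : {measure set (borel X) -> \bar R}) (x : X) :
  \bar R := \int[mu]_y K x y.

Definition pot_fun K (sigma : {measure set (borel X) -> \bar R})
  (f : X -> R) (x : X) : \bar R := \int[sigma]_y (K x y * (f y)%:E).

Definition locally_finite K (mu : {measure set (borel X) -> \bar R}) :=
  forall B : set (borel X), measurable B ->
    ereal_sup [set qrho K z.1 z.2 | z in B `*` B] < +oo -> mu B < +oo.

Definition stable K (mu : {measure set (borel X) -> \bar R}) :=
  locally_finite K mu /\
  exists C delta : R, [/\ (0 < C)%R, (0 < delta)%R &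
    forall x (r s : R), (0 < r)%R -> (r < s)%R ->
      mu (qball K x (2 * s)) <= C%:E * mu (qball K x s) /\
      mu (qball K x r) <= (C * (r / s) `^ (1 + delta))%:E * mu (qball K x s)].

End kernel.

(* The classes of functions below consist of extended-real-valued Borel
   functions (potentials may be infinite) and are invariant under modification
   sigma-a.e., so that an equality between them is an equality between sets of
   sigma-a.e. classes. *)
Section function_classes.
Context {R : realType} {X : pmetricType R}.
Variables (K : X -> X -> \bar R).
Variable sigma : {sigma_finite_measure set (borel X) -> \bar R}.

Definition zero_class : set (X -> \bar R) :=
  [set f | measurable_fun [set: borel X] f /\ \forall x \ae sigma, f x = 0].

Definition classZ (q : R) : set (X -> \bar R) :=
  [set f | measurable_fun [set: borel X] f /\
    exists eps : R, (0 < eps)%R /\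
    exists u : X -> R, [/\ measurable_fun [set: borel X] u,
      forall x, (0 <= u x)%R &
      \forall x \ae sigma,
        (u x)%:E = pot_fun K sigma (fun y => (u y `^ q)%R) x + eps%:E * `|f x|]].

Definition classY (p q : R) : set (X -> \bar R) :=
  [set f | [/\ measurable_fun [set: borel X] f,
    \forall x \ae sigma, f x \is a fin_num &
    exists C : R, forall g : X -> R, g \in Lfun sigma p%:E ->
      (forall x, (0 <= g x)%R) ->
      \int[sigma]_x (`|f x| `^ q * pot_fun K sigma g x `^ p)
        <= C%:E * \int[sigma]_x (g x `^ p)%:E]].

Definition classW (p : R)
    (omega : {sigma_finite_measure set (borel X) -> \bar R}) : Prop :=
  exists C : R, forall g : X -> R, g \in Lfun sigma p%:E ->
    (forall x, (0 <= g x)%R) ->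
    \int[omega]_x (pot_fun K sigma g x `^ p)
      <= C%:E * \int[sigma]_x (g x `^ p)%:E.

Definition ball_growth_condition (q : R) :=
  exists C : R, forall (x : X) (a : R), (0 < a)%R ->
    \int[lebesgue_measure]_(t in `]0%R, a[) (sigma (qball K x t) / (t ^+ 2)%:E)
    <= (C * a `^ (q - 1))%:E *
       \int[lebesgue_measure]_(t in `]a, +oo[)
          (sigma (qball K x t) / (t `^ (1 + q))%:E).

End function_classes.

(* Main.v *)
Require Import Defs.
From HB Require Import structures.
From mathcomp Require Import all_boot all_order all_algebra.
From mathcomp Require Import all_classical all_reals all_analysis.
From mathcomp Require Import measurable_realfun.
From mathcomp Require Import ring lra.

Set Implicit Arguments.
Unset Strict Implicit.
Unset Printing Implicit Defensive.

Import Order.TTheory GRing.Theory Num.Theory.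
Import numFieldNormedType.Exports.

Local Open Scope classical_set_scope.
Local Open Scope ring_scope.

(** Write rho = 1/K, B_t(x) for the balls of rho, S = int_0^a sigma(B_t(x)) / t^2 dt
    and J = int_a^oo sigma(B_t(x)) / t^(1+q) dt.  The claim is S <= C a^(q-1) J,
    uniformly in x and a.

    Upper bound for S.  Suppose u >= K(u^q) + e K omega holds sigma-a.e. and let
    A(t) = int u^q / max(t, rho(x,.)) dsigma + e int 1 / max(t, rho(x,.)) domega.
    The quasi-metric inequality gives A(t) <= 2 k u a.e. on B_t(x), so that halving
    the radius increases A by at least (A(t) / 2k)^q sigma(B_t(x)) / 2t.  This is a
    discrete form of -A' >= c A^q sigma(B_t(x)) / t^2; since A^(-q) dA integrates to
    A^(1-q) / (1-q), summing over dyadic radii yields S <= C A(a)^(1-q)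
    ([riccati_bound]).  It remains to find supersolutions for which A(a) is large.

    A test measure for one ball.  If mu is stable and B = B_a(x), its potential
    satisfies K(mu|B) <= M mu(B) / max(a, rho(x,.)) ([stable_potential]), hence
    int (K(mu|B))^q dsigma <= C mu(B)^q J.  By Chebyshev and Hoelder there is G in B
    carrying at least half of the mass of B with
    int_G (Kg)^p dmu <= h^(p-1) int g^p dsigma,  h = C mu(B)^(q-1) J
    ([two_weight_large_set], [stable_test_set]); the points of B where the potential
    of (K(mu|B))^(q-1) sigma is large are left out.  So omega = h^(1-p) mu|G
    satisfies the trace inequality with constant 1.  If a supersolution charges
    omega with a factor e, then A(a) >= e h^(1-p) mu(B) / 2a, and because
    (p-1)(q-1) = 1 the bound above becomes S <= C e^(1-q) a^(q-1) J.

    Uniformity.  If the condition fails, choose balls violating it with constants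
    (n+1) 2^((n+1)(q-1)) and superpose their test measures with weights 2^(-n-1).
    The sum omega satisfies the trace inequality and is sigma-finite, so the
    hypothesis provides a supersolution with one factor e for all n at once: for
    K omega directly, or, when mu << sigma, for the density function
    f = (domega/dsigma)^(1/q), since then u >= eps f makes u^q dsigma dominate
    eps^q omega.  For large n this contradicts the choice of the balls
    ([ball_growth_criterion]).

    Measurability.  Tonelli requires a kernel measurable for the product of the
    Borel sigma-algebras.  All balls have positive and finite mass for a stable
    measure, so X is separable for rho, and K is comparable to the supremum of
    min(K(y,d), K(z,d)) over a countable dense set of points d, which is measurable
    for the product ([net_kernel]). *)

(** * Series, integrals and measures *)

Section integral_monotone.
Local Open Scope ereal_scope.
Context d (T : measurableType d) (R : realType).
Variable mu : {measure set T -> \bar R}.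

(** The integral of a nonnegative function is a supremum over the simple functions
    below it, hence monotone without any measurability; this is needed because a
    potential of K need not be a measurable function. *)
Lemma le_integral_ge0 (D : set T) (f g : T -> \bar R) :
  (forall x, D x -> 0 <= f x) -> (forall x, D x -> f x <= g x) ->
  \int[mu]_(x in D) f x <= \int[mu]_(x in D) g x.
Proof.
move=> f0 fg.
rewrite !ge0_integralE//; last by move=> x Dx; exact: le_trans (f0 _ Dx) (fg _ Dx).
apply: le_ereal_sup => _ /= [h hf <-]; exists h => // x.
apply: le_trans (hf x) _.
by apply: lee_restrict.
Qed.

End integral_monotone.

Lemma nneseries_ge_term {R : realType} (f : nat -> \bar R) k :
  (forall k, 0 <= f k)%E -> (f k <= \sum_(k <oo) f k)%E.
Proof.
move=> f0; apply: le_trans (nneseries_lim_ge k.+1 _); last by [].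
by rewrite big_nat_recr//= leeDr// sume_ge0.
Qed.

Lemma nneseriesZr_ge0 {R : realType} (f : nat -> \bar R) (x : \bar R) :
  (forall n, 0 <= f n)%E -> (0 <= x)%E ->
  ((\sum_(n <oo) f n) * x = \sum_(n <oo) (f n * x))%E.
Proof.
move=> f0; case: x => [r||]// x0.
  by rewrite muleC -nneseriesZl//; apply: eq_eseriesr => n _; rewrite muleC.
have [fn0|/existsNP[n /eqP fn]] := pselect (forall n, f n = 0%E).
  rewrite !eseries0 ?mul0e// => n _ _; rewrite fn0//.
  by rewrite mul0e.
have {}fn : (0 < f n)%E by rewrite lt_def fn f0.
rewrite gt0_muley; last exact: lt_le_trans fn (nneseries_ge_term n f0).
apply/esym/eqP; rewrite -leye_eq.
have := nneseries_ge_term n (f := fun n => f n * +oo)%E (fun n => mule_ge0 (f0 n) (leey _)).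
by rewrite gt0_muley.
Qed.

Lemma sum_geometric_le {R : realType} (t : R) n : 0 <= t -> t < 1 ->
  \sum_(0 <= i < n) t ^+ i <= (1 - t)^-1.
Proof.
move=> t0 t1; have t10 : 0 < 1 - t by rewrite subr_gt0.
suff : (1 - t) * \sum_(0 <= i < n) t ^+ i <= 1.
  by move=> h; rewrite -(ler_pM2l t10) mulfV// gt_eqF.
suff -> : (1 - t) * \sum_(0 <= i < n) t ^+ i = 1 - t ^+ n.
  by have := exprn_ge0 n t0; lra.
elim: n => [|n IH]; first by rewrite big_nil mulr0 expr0 subrr.
by rewrite big_nat_recr//= mulrDr IH exprS; ring.
Qed.

Lemma sum_half_pow {R : realType} n : \sum_(0 <= i < n) (2 ^+ i.+1)^-1 <= 1 :> R.
Proof.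
suff -> : \sum_(0 <= i < n) (2 ^+ i.+1)^-1 = 1 - (2 ^+ n)^-1 :> R.
  by rewrite gerBl invr_ge0 exprn_ge0.
elim: n => [|n IH]; first by rewrite big_nil expr0 invr1 subrr.
rewrite big_nat_recr//= IH exprS; field.
by rewrite gt_eqF// exprn_gt0.
Qed.

Lemma ge0_integral_mrestr d (T : measurableType d) (R : realType)
    (mu : {measure set T -> \bar R}) (G : set T) (mG : measurable G)
    (Goo : (mu G < +oo)%E) (f : T -> \bar R) :
  measurable_fun setT f -> (forall x, 0 <= f x)%E ->
  (\int[mfrestr mG Goo]_x f x = \int[mu]_(x in G) f x)%E.
Proof.
move=> mf f0.
rewrite (@ge0_negligible_integral _ _ _ _ setT (~` G))//; last 2 first.
- exact: measurableC.
- by rewrite /= /mfrestr /mrestr setICl measure0.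
rewrite setTD setCK; apply: eq_measure_integral => A mA AG.
by rewrite /= /mfrestr /mrestr setIidl.
Qed.

Section with_sigma_finite.
Context d (T : measurableType d) (R : realType).
Variable m : {measure set T -> \bar R}.
Hypothesis sf : sigma_finite setT m.

(** The proof is an argument so that the sigma-finite structure can be attached to
    this function, which has the values of m. *)
Definition with_sigma_finite (_ : sigma_finite setT m) (A : set T) : \bar R := m A.

HB.instance Definition _ := Measure.copy (with_sigma_finite sf) m.
HB.instance Definition _ := @Measure_isSigmaFinite.Build _ _ _ (with_sigma_finite sf) sf.

End with_sigma_finite.

Section weighted_series.
Context d (T : measurableType d) (R : realType).
Variable mu : {measure set T -> \bar R}.
Variables (w : nat -> R) (G : nat -> set T).
Hypothesis w0 : forall n, 0 < w n.
Hypothesis mG : forall n, measurable (G n).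
Hypothesis Goo : forall n, (mu (G n) < +oo)%E.

Definition weighted_series :=
  mseries (fun n => mscale (NngNum (ltW (w0 n))) (mfrestr (mG n) (Goo n))) 0.

HB.instance Definition _ := Measure.on weighted_series.

Local Open Scope ereal_scope.

Lemma integral_weighted_series (F : T -> \bar R) : measurable_fun setT F ->
  (forall y, 0 <= F y) ->
  \int[weighted_series]_y F y = \sum_(n <oo) ((w n)%:E * \int[mu]_(y in G n) F y).
Proof.
move=> mF F0; rewrite ge0_integral_measure_series//.
apply: eq_eseriesr => n _; rewrite ge0_integral_mscale//=.
by rewrite ge0_integral_mrestr.
Qed.

End weighted_series.

(** Only finitely many of the disjoint sets can have measure above a given
    threshold inside a set of finite measure. *)
Lemma countable_disjoint_pos_measure d (T : measurableType d) (R : realType)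
    (mu : {measure set T -> \bar R}) (I : pointedType) (D : set I)
    (F : I -> set T) (B : set T) :
  (forall i, measurable (F i)) -> measurable B -> (mu B < +oo)%E ->
  trivIset D F -> (forall i, D i -> F i `<=` B) ->
  (forall i, D i -> (0 < mu (F i))%E) -> countable D.
Proof.
move=> mF mB Bfin tF FB F0.
have -> : D = \bigcup_j [set i | D i /\ (j.+1%:R^-1%:E <= mu (F i))%E].
  apply/seteqP; split => [i Di|i [j _ []]//].
  have [e [e0 ei]] : exists e : R, 0 < e /\ (e%:E <= mu (F i))%E.
    have := F0 _ Di; case E : (mu (F i)) => [r||]//.
      by rewrite lte_fin => r0; exists r.
    by move=> _; exists 1; rewrite leey.
  exists (Num.truncn e^-1) => //; split => //; apply: le_trans ei.
  rewrite lee_fin -[leRHS]invrK lef_pV2 ?posrE ?invr_gt0//.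
  by apply: ltW; exact: truncnS_gt.
apply: bigcup_countable => // j _; apply: finite_set_countable.
apply: contrapT => /infiniteP/ppcard_leP[f].
have hf n : D (f n) /\ (j.+1%:R^-1%:E <= mu (F (f n)))%E by exact: (@funS _ _ _ _ f n).
have fin : mu B \is a fin_num by rewrite ge0_fin_numE.
pose b := fine (mu B).
have tf : trivIset setT (F \o f).
  move=> a c _ _ /= ac; have fe := tF (f a) (f c) (hf a).1 (hf c).1 ac.
  by apply: (@inj _ _ _ f); rewrite ?inE.
have le_b n : n%:R / j.+1%:R <= b.
  rewrite -lee_fin /b fineK//.
  apply: (@le_trans _ _ (\sum_(0 <= i < n) mu (F (f i)))%E).
    apply: (@le_trans _ _ (\sum_(0 <= i < n) (j.+1%:R^-1)%:E)%E); last first.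
      by apply: lee_sum => i _; exact: (hf i).2.
    by rewrite sumEFin lee_fin sumr_const_nat subn0 -[leRHS]mulr_natl.
  apply: (@le_trans _ _ (\sum_(i <oo) mu (F (f i)))%E); first exact: nneseries_lim_ge.
  rewrite (_ : \sum_(i <oo) _ = mu (\bigcup_i F (f i)))%E; last first.
    rewrite (measure_bigcup mu setT (F \o f))//; last by move=> i _; exact: mF.
    by apply: eq_eseriesl => i; rewrite in_setT.
  apply: le_measure; rewrite ?inE//; first by apply: bigcup_measurable => i _; exact: mF.
  by move=> x [i _ Fx]; exact: FB (hf i).1 _ Fx.
have b0 : 0 <= b by rewrite fine_ge0.
have := le_b (Num.truncn (b * j.+1%:R)).+1.
rewrite ler_pdivrMr// leNgt => /negP; apply; exact: truncnS_gt.
Qed.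

(** * The quasi-metric 1/K and its balls *)

Section rho.
Context {R : realType} {X : pmetricType R}.
Variable K : X -> X -> \bar R.
Hypothesis hK : quasi_metric_kernel K.

(** rho is finite everywhere since K never vanishes. *)
Definition rho x y : R := fine (qrho K x y).

Lemma qrhoE x y : qrho K x y = (rho x y)%:E.
Proof.
rewrite /rho /qrho fineK//; have := qmk_gt0 hK x y.
by case: (K x y) => [r r0||]//; rewrite inver gt_eqF.
Qed.

Lemma rho_ge0 x y : 0 <= rho x y.
Proof.
rewrite /rho /qrho; have := qmk_gt0 hK x y.
case: (K x y) => [r||] //=.
by rewrite lte_fin => r0; rewrite inver gt_eqF//= invr_ge0 ltW.
Qed.

Lemma rho_sym x y : rho x y = rho y x.
Proof. by rewrite /rho /qrho (qmk_sym hK). Qed.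

Lemma rho_quasi : exists2 k : R, 1 <= k &
  forall x y z, rho x y <= k * (rho x z + rho z y).
Proof.
have [k k1 tri] := qmk_quasi hK; exists k => // x y z.
by have := tri x y z; rewrite !qrhoE -EFinD -EFinM lee_fin.
Qed.

Lemma kernel_rho_gt0 x y : 0 < rho x y -> K x y = (rho x y)^-1%:E.
Proof.
rewrite /rho /qrho; have := qmk_gt0 hK x y.
case: (K x y) => [r||]//; last by rewrite ltxx.
by rewrite lte_fin => r0 _; rewrite inver gt_eqF//= invrK.
Qed.

Lemma kernel_rho_eq0 x y : rho x y = 0 -> K x y = +oo%E.
Proof.
rewrite /rho /qrho; have := qmk_gt0 hK x y.
case: (K x y) => [r||]//; rewrite lte_fin => r0.
by rewrite inver gt_eqF//= => /eqP; rewrite invr_eq0 gt_eqF.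
Qed.

Lemma kernel_geV x y t : 0 < t -> rho x y <= t -> (t^-1%:E <= K x y)%E.
Proof.
move=> t0 xyt; have := rho_ge0 x y; rewrite le_eqVlt => /orP[/eqP/esym r0|r0].
  by rewrite kernel_rho_eq0// leey.
by rewrite kernel_rho_gt0// lee_fin lef_pV2.
Qed.

Lemma kernel_leV x y t : 0 < t -> t <= rho x y -> (K x y <= t^-1%:E)%E.
Proof.
move=> t0 xyt; have r0 : 0 < rho x y by exact: lt_le_trans xyt.
by rewrite kernel_rho_gt0// lee_fin lef_pV2.
Qed.

Lemma kernel_ge0 x y : (0 <= K x y)%E. Proof. exact/ltW/(qmk_gt0 hK). Qed.

Lemma in_qball x t y : (qball K x t y) = (rho x y <= t) :> Prop.
Proof. by rewrite /qball/= qrhoE lee_fin. Qed.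

(** The map y |-> (x, y) is continuous, so sections of a Borel kernel are Borel even
    when K is not measurable for the product of the Borel sigma-algebras. *)
Lemma measurable_kernel_section x : measurable_fun [set: borel X] (K x : borel X -> _).
Proof.
pose c : borel X -> borel (X * X)%type := fun y => (x, y).
have mc : measurable_fun setT c.
  apply: (@measurability _ _ _ _ _ c (@open (X * X)%type)) => //.
  move=> _ [U oU <-]; rewrite setTI.
  apply: sub_sigma_algebra.
  have cc : continuous (fun y : X => (x, y)).
    by move=> y; apply: cvg_pair; [exact: cvg_cst|exact: cvg_id].
  by move/continuousP : cc; apply.
by have := measurableT_comp (qmk_borel hK) mc.
Qed.

Lemma measurable_qball x t : measurable (qball K x t : set (borel X)).
Proof.
have [t0|t0] := ltP t 0.
  rewrite (_ : qball _ _ _ = set0)//; apply/seteqP; split => y //.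
  by rewrite in_qball => xyt; have := rho_ge0 x y; lra.
have -> : qball K x t = setT `&` [set y : borel X | (t%:E^-1 <= K x y)%E].
  apply/seteqP; split => y; rewrite in_qball.
    move=> xyt; split => //=; move: t0; rewrite le_eqVlt => /orP[/eqP t0|t0].
      by rewrite kernel_rho_eq0 ?leey//; have := rho_ge0 x y; lra.
    by rewrite inver gt_eqF// kernel_geV.
  move=> [_ /=]; have := rho_ge0 x y; rewrite le_eqVlt => /orP[/eqP/esym r0|r0].
    by rewrite r0.
  rewrite kernel_rho_gt0// inver; case: eqVneq => [_|tn0]; first by rewrite leye_eq.
  by rewrite lee_fin lef_pV2// posrE lt_def tn0.
by apply: emeasurable_fun_c_infty => //; exact: measurable_kernel_section.
Qed.

Lemma measurable_rho x : measurable_fun [set: borel X] (rho x : borel X -> R).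
Proof.
move=> mD; apply: (measurability _ (RGenOInfty.measurableE R)) => //.
move=> /= _ [_ [r ->] <-]; rewrite setTI.
rewrite (_ : _ @^-1` _ = ~` (qball K x r)); first by apply: measurableC; exact: measurable_qball.
by apply/seteqP; split => y /=; rewrite in_itv/= andbT -/(qball K x r y) in_qball;
  [move=> ?; apply/negP; rewrite -ltNge|move/negP; rewrite -ltNge].
Qed.

End rho.

(** * Dyadic radii *)

Section dyadic.
Context {R : realType}.

Lemma dyadic_bracket (s : R) : 1 <= s -> exists k : nat, 2 ^+ k <= s < 2 ^+ k.+1.
Proof.
move=> s1; have s0 : 0 <= s by lra.
have := truncn_itv s0; set m := Num.truncn s => /andP[ms sm].
have m0 : (0 < m)%N by rewrite truncn_ge_nat// in ms *; rewrite truncn_gt0.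
exists (trunc_log 2 m); apply/andP; split.
  by apply: le_trans ms; rewrite -natrX ler_nat trunc_logP.
by apply: lt_le_trans sm _; rewrite -natrX ler_nat trunc_log_ltn.
Qed.

Local Open Scope ereal_scope.
Variable N : R -> \bar R.
Hypothesis N0 : forall t, 0 <= N t.
Hypothesis Nnd : forall s t, (s <= t)%R -> N s <= N t.
Local Notation leb := (@lebesgue_measure R).

(** On the dyadic interval below a / 2^k the integrand is at most
    N(a / 2^k) (2^(k+1) / a)^2, and the interval has length a / 2^(k+1). *)
Lemma integral_small_radii (a : R) (M : \bar R) : (0 < a)%R ->
  (forall n, \sum_(0 <= k < n) (N (a / 2 ^+ k) * (2 ^+ k / a)%:E) <= M) ->
  \int[leb]_(t in `]0%R, a[) (N t / (t ^+ 2)%:E) <= 2%:E * M.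
Proof.
move=> a0 hM.
pose I k := `](a / 2 ^+ k.+1)%R, (a / 2 ^+ k)%R]%classic : set R.
pose g k (t : R) := (N (a / 2 ^+ k) * ((2 ^+ k.+1 / a) ^+ 2)%:E) * (\1_(I k) t)%:E.
have pow0 k : (0 < 2 ^+ k :> R)%R by rewrite exprn_gt0.
have g0 k t : 0 <= g k t by rewrite !mule_ge0// lee_fin sqr_ge0.
have mI k : measurable (I k) by exact: measurable_itv.
apply: (@le_trans _ _ (\int[leb]_(t in `]0%R, a[) (\sum_(k <oo) g k t))).
  apply: le_integral_ge0 => t /=; rewrite in_itv/= => /andP[t0 ta].
    by rewrite mule_ge0// inver gt_eqF ?exprn_gt0// lee_fin invr_ge0 sqr_ge0.
  have [k /andP[k1 k2]] : exists k : nat, (2 ^+ k <= a / t < 2 ^+ k.+1)%R.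
    by apply: dyadic_bracket; rewrite ler_pdivlMr// mul1r ltW.
  have tk : (t <= a / 2 ^+ k)%R by rewrite ler_pdivlMr// mulrC -ler_pdivlMr.
  have kt : (a / 2 ^+ k.+1 < t)%R by rewrite ltr_pdivrMr// mulrC -ltr_pdivrMr.
  apply: (@le_trans _ _ (g k t)).
    rewrite /g indicE mem_set /= ?mule1; last by rewrite /I /= in_itv/= kt tk.
    rewrite inver gt_eqF ?exprn_gt0//; apply: lee_pmul => //.
    - by rewrite lee_fin invr_ge0 sqr_ge0.
    - exact: Nnd.
    - rewrite lee_fin -exprVn lerXn2r ?nnegrE ?invr_ge0 ?ltW// ?divr_gt0//.
      by rewrite ltr_pdivlMr// mulrC.
  exact: nneseries_ge_term.
rewrite integral_nneseries//; last first.
  move=> k; apply: measurable_funeM; apply/measurable_EFinP.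
  exact: (@measurable_indic _ _ _ _ (I k) (mI k)).
apply: lime_le; first by apply: is_cvg_nneseries => k _ _; exact: integral_ge0.
apply: nearW => n.
apply: (@le_trans _ _ (\sum_(0 <= k < n) (2%:E * (N (a / 2 ^+ k) * (2 ^+ k / a)%:E)))).
  apply: lee_sum => k _.
  rewrite /g ge0_integralZl//; last 2 first.
    by apply/measurable_EFinP; exact: (@measurable_indic _ _ _ _ (I k) (mI k)).
    by rewrite mule_ge0// lee_fin sqr_ge0.
  rewrite integral_indic; [|exact: measurable_itv|exact: mI].
  apply: (@le_trans _ _ (N (a / 2 ^+ k) * ((2 ^+ k.+1 / a) ^+ 2)%:E * leb (I k))).
    apply: lee_wpmul2l; first by rewrite mule_ge0// lee_fin sqr_ge0.
    by apply: le_measure; rewrite ?inE//; [apply: measurableI; [exact: mI|exact: measurable_itv]|exact: mI].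
  rewrite lebesgue_measure_itv/= lte_fin ifT; last first.
    by rewrite ltr_pM2l// ltf_pV2 ?posrE ?exprn_gt0// [ltRHS]exprS; have := pow0 k; lra.
  rewrite -EFinB -muleA -EFinM muleCA -EFinM.
  apply: lee_wpmul2l => //; rewrite lee_fin.
  have a1 := pow0 k. rewrite !exprS.
  set b := (2 ^+ k)%R in a1 *.
  rewrite le_eqVlt; apply/orP; left; apply/eqP; field.
  by rewrite !gt_eqF.
rewrite -ge0_sume_distrr; last by move=> i _; rewrite mule_ge0// lee_fin divr_ge0 ?ltW.
by apply: lee_wpmul2l.
Qed.

(** The term of index k is compared with the integral over [2^(k+1) a, 2^(k+2) a[,
    where N is at least N(2^(k+1) a). *)
Lemma sum_large_radii (a q : R) : (0 < a)%R -> (0 <= q)%R ->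
  \sum_(k <oo) (N (2 ^+ k.+1 * a) * ((2 ^+ k * a) `^ (- q))%:E) <=
  (2 * 4 `^ q)%:E * \int[leb]_(t in `]a, +oo[) (N t / (t `^ (1 + q))%:E).
Proof.
move=> a0 q0.
have pow0 k : (0 < 2 ^+ k :> R)%R by rewrite exprn_gt0.
pose I k := `[(2 ^+ k.+1 * a)%R, (2 ^+ k.+2 * a)%R[%classic : set R.
have mI k : measurable (I k) by exact: measurable_itv.
pose c k := (N (2 ^+ k.+1 * a) * ((2 ^+ k.+2 * a) `^ (- (1 + q)))%:E).
have c0 k : 0 <= c k by rewrite mule_ge0// lee_fin powR_ge0.
apply: (@le_trans _ _ ((2 * 4 `^ q)%:E * \int[leb]_(t in `]a, +oo[) \sum_(k <oo) (c k * (\1_(I k) t)%:E))).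
  rewrite integral_nneseries//; last 2 first.
    move=> k; apply: measurable_funeM; apply/measurable_EFinP.
    exact: (@measurable_indic _ _ _ _ (I k) (mI k)).
    by move=> k t _; rewrite mule_ge0.
  rewrite -nneseriesZl; last by move=> k _; apply: integral_ge0 => t _; rewrite mule_ge0.
  apply: lee_nneseries => k _; first by rewrite mule_ge0// lee_fin powR_ge0.
  rewrite ge0_integralZl//; last by apply/measurable_EFinP; exact: (@measurable_indic _ _ _ _ (I k) (mI k)).
  rewrite integral_indic; [|exact: measurable_itv|exact: mI].
  rewrite setIidl; last first.
    move=> t; rewrite /I /= !in_itv/= andbT => /andP[kt _]; apply: lt_le_trans kt.
    by rewrite ltr_pMl// exprn_egt1// ltr1n.
  suff : N (2 ^+ k.+1 * a) * ((2 ^+ k * a) `^ (- q))%:E <= (2 * 4 `^ q)%:E * (c k * leb (I k)) by [].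
  rewrite lebesgue_measure_itv/= lte_fin ifT; last first.
    by rewrite ltr_pM2r// [ltRHS]exprS; have := pow0 k.+1; lra.
  rewrite /c -EFinB -[in leRHS]muleA -EFinM muleCA -EFinM.
  apply: lee_wpmul2l => //; rewrite lee_fin.
  have ak : (0 < 2 ^+ k * a)%R by rewrite mulr_gt0.
  have -> : (2 ^+ k.+2 * a = 4 * (2 ^+ k * a) :> R)%R by rewrite !exprS; ring.
  have -> : (2 ^+ k.+1 * a = 2 * (2 ^+ k * a) :> R)%R by rewrite !exprS; ring.
  set b := (2 ^+ k * a)%R in ak *.
  rewrite [in leRHS]powRN powRD; last by rewrite (_ : (4 * b == 0)%R = false) ?implybT// gt_eqF// mulr_gt0.
  rewrite powRr1; last by rewrite mulr_ge0// ltW.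
  rewrite powRM//; last exact: ltW.
  rewrite powRN.
  have b0 : (0 < b `^ q)%R by rewrite powR_gt0.
  have f0 : (0 < 4 `^ q :> R)%R by rewrite powR_gt0.
  rewrite le_eqVlt; apply/orP; left; apply/eqP; field.
  by rewrite !gt_eqF.
apply: lee_wpmul2l; first by rewrite lee_fin mulr_ge0// powR_ge0.
apply: le_integral_ge0 => t /=; rewrite in_itv/= andbT => at'.
  by apply: nneseries_ge0 => k _ _; rewrite mule_ge0.
have t0 : (0 < t)%R by exact: lt_trans at'.
have f0 : 0 <= N t / (t `^ (1 + q))%:E.
  by rewrite mule_ge0// inver gt_eqF ?powR_gt0// lee_fin invr_ge0 powR_ge0.
apply: lime_le; first by apply: is_cvg_nneseries => k _ _; rewrite mule_ge0.
apply: nearW => n.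
have [k /andP[k1 k2]] : exists k : nat, (2 ^+ k <= t / a < 2 ^+ k.+1)%R.
  by apply: dyadic_bracket; rewrite ler_pdivlMr// mul1r ltW.
have {}k1 : (2 ^+ k * a <= t)%R by rewrite -ler_pdivlMr.
have {}k2 : (t < 2 ^+ k.+1 * a)%R by rewrite -ltr_pdivrMr.
have gt1 : (1 < 2 :> R)%R by rewrite ltr1n.
have Ij j : I j t -> j.+1 = k.
  rewrite /I /= in_itv/= => /andP[j1 j2]; apply/eqP; rewrite eqn_leq; apply/andP; split.
    rewrite -ltnS -(ltr_eXn2l gt1).
    by have := le_lt_trans j1 k2; rewrite ltr_pM2r.
  rewrite -ltnS -(ltr_eXn2l gt1).
  by have := le_lt_trans k1 j2; rewrite ltr_pM2r.
apply: (@le_trans _ _ (\sum_(0 <= j < n) (if j == k.-1 then (N t / (t `^ (1 + q))%:E) else 0))).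
  apply: lee_sum => j _; rewrite indicE.
  case: (boolP (t \in I j)) => [|_]; last by rewrite mule0; case: ifP.
  rewrite inE => It; rewrite -(Ij _ It) /= eqxx mule1.
  rewrite /c inver gt_eqF ?powR_gt0//=; apply: lee_pmul => //.
  - by rewrite lee_fin powR_ge0.
  - by apply: Nnd; move: It; rewrite /I /= in_itv/= => /andP[].
  - move: It; rewrite /I /= in_itv/= => /andP[_ /ltW tj].
    have ak : (0 < 2 ^+ j.+2 * a)%R by rewrite mulr_gt0.
    rewrite lee_fin powRN lef_pV2 ?posrE ?(powR_gt0 _ ak) ?(powR_gt0 _ t0)//.
    by apply: ge0_ler_powR => //; rewrite ?nnegrE ?addr_ge0// ltW.
by rewrite -big_mkcond big_nat1_eq; case: ifP.
Qed.

End dyadic.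

(** * A discrete Riccati inequality for supersolutions *)

(** Bernoulli's inequality for a negative exponent: x^s = exp(s ln x), and
    s ln x >= s (x - 1). *)
Lemma powR_ge_tangent {R : realType} (x s : R) : 0 < x -> s <= 0 ->
  1 + s * (x - 1) <= x `^ s.
Proof.
move=> x0 s0; rewrite /powR gt_eqF//.
apply: le_trans (expR_ge1Dx _); rewrite lerD2l.
rewrite ler_wnM2l//.
have := @le_ln1Dx R (x - 1); rewrite (addrC 1) subrK; apply; lra.
Qed.

(** Comparison of (b - a) b^(-q) with the integral of t^(-q) over [a, b]; it makes
    the sums of the discrete Riccati inequality telescope. *)
Lemma powR_decrement {R : realType} (a b q : R) : 1 < q -> 0 < a -> 0 < b ->
  (b - a) * b `^ (- q) <= (a `^ (1 - q) - b `^ (1 - q)) / (q - 1).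
Proof.
move=> q1 a0 b0; have q10 : 0 < q - 1 by lra.
rewrite ler_pdivlMr//.
have q1' : 1 - q <= 0 by lra.
have := @powR_ge_tangent R (a / b) (1 - q) (divr_gt0 a0 b0) q1'.
rewrite powRM ?invr_ge0 ?(ltW a0) ?(ltW b0)//.
rewrite -{2}(powR_inv1 (ltW b0)) -powRrM mulN1r.
have B0 : 0 < b `^ (1 - q) by rewrite powR_gt0.
rewrite -(ler_pM2r B0) -mulrA -powRD; last by rewrite (gt_eqF b0) implybT.
rewrite addNr powRr0 mulr1 => h.
have -> : b `^ (- q) = b `^ (1 - q) / b.
  rewrite -[X in _ / X](powRr1 (ltW b0)) -powRN -powRD; last by rewrite (gt_eqF b0) implybT.
  by congr (_ `^ _); ring.
have -> : (b - a) * (b `^ (1 - q) / b) * (q - 1) =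
  (1 + (1 - q) * (a / b - 1)) * b `^ (1 - q) - b `^ (1 - q) by field; rewrite gt_eqF.
by rewrite lerB.
Qed.

Section riccati.
Context {R : realType} {X : pmetricType R}.
Variable K : X -> X -> \bar R.
Hypothesis hK : quasi_metric_kernel K.
Variables (k q : R).
Hypothesis k1 : 1 <= k.
Hypothesis tri : forall x y z, rho K x y <= k * (rho K x z + rho K z y).
Hypothesis q1 : 1 < q.
Variable sigma : {sigma_finite_measure set (borel X) -> \bar R}.
Variable omega : {measure set (borel X) -> \bar R}.
Variables (u : X -> R) (e : R).
Hypothesis mes_u : measurable_fun [set: borel X] u.
Hypothesis u0 : forall x, 0 <= u x.
Hypothesis e0 : 0 <= e.
Local Notation pot x := (pot_fun K sigma (fun y => (u y `^ q)%R) x +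
  e%:E * pot_measure K omega x)%E.
Hypothesis hu : {ae sigma, forall x, (pot x <= (u x)%:E)%E}.
Hypothesis sigma0 : sigma setT != 0%E.

Definition trunc_kernel x t z := (Num.max t (rho K x z))^-1.

Lemma trunc_kernel_gt0 x t z : 0 < t -> 0 < trunc_kernel x t z.
Proof. by move=> t0; rewrite invr_gt0 lt_max t0. Qed.

Lemma measurable_trunc_kernel x t : measurable_fun [set: borel X] (trunc_kernel x t).
Proof.
rewrite (_ : trunc_kernel x t = (fun z => (Num.max t (rho K x z)) `^ (-1))).
  apply: (measurableT_comp (measurable_powR (-1))).
  by apply: measurable_maxr => //; exact: measurable_rho.
by apply/funext => z; rewrite powR_inv1// le_max rho_ge0// orbT.
Qed.

(** The quantity A(t) of the Riccati inequality, for the measure u^q sigma + e omega: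
    up to the factor 2k, a lower bound for its potential on B_t(x). *)
Definition trunc_pot x t : \bar R :=
  (\int[sigma]_z (u z `^ q * trunc_kernel x t z)%:E +
   e%:E * \int[omega]_z (trunc_kernel x t z)%:E)%E.

Let muq : measurable_fun [set: borel X] (fun z => u z `^ q).
Proof.
by apply: (measurableT_comp (measurable_powR q)).
Qed.

Lemma trunc_kernel_le x y t z : 0 < t -> rho K x y <= t ->
  ((trunc_kernel x t z)%:E <= (2 * k)%:E * K y z)%E.
Proof.
move=> t0 xyt; rewrite /trunc_kernel; set s := Num.max _ _.
have s0 : 0 < s by rewrite lt_max t0.
have k0 : 0 < k by exact: lt_le_trans ltr01 k1.
have : rho K y z <= 2 * k * s.
  have := tri y z x; rewrite (rho_sym hK y x).
  have : t <= s by rewrite le_max lexx.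
  have : rho K x z <= s by rewrite le_max lexx orbT.
  move=> h1 h2 h3; apply: le_trans h3 _.
  by rewrite [leRHS](_ : _ = k * (2 * s)); [rewrite ler_pM2l//; lra|ring].
have ks : 0 < 2 * k * s by rewrite !mulr_gt0.
move/(kernel_geV hK ks) => h.
apply: le_trans (lee_wpmul2l _ h); last by rewrite lee_fin mulr_ge0// ltW.
rewrite -EFinM lee_fin le_eqVlt; apply/orP; left; apply/eqP; field.
by rewrite !gt_eqF.
Qed.

Local Open Scope ereal_scope.

(** On B_t(x) the kernel K(y,.) dominates 1 / max(t, rho(x,.)) up to the factor 2k. *)
Lemma trunc_pot_le x y t : (0 < t)%R -> (rho K x y <= t)%R ->
  trunc_pot x t <= (2 * k)%:E * pot y.
Proof.
move=> t0 xyt; have k0 : (0 <= 2 * k)%R by move: (k1) (q1); lra.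
have mK := measurable_kernel_section hK y.
rewrite ge0_muleDr; last 2 first.
- by apply: integral_ge0 => z _; rewrite mule_ge0 ?kernel_ge0// lee_fin powR_ge0.
- by rewrite mule_ge0//; apply: integral_ge0 => z _; exact: kernel_ge0.
apply: leeD.
  rewrite /pot_fun -ge0_integralZl//; last 2 first.
  - by apply: emeasurable_funM => //; exact/measurable_EFinP.
  - by move=> z _; rewrite mule_ge0 ?kernel_ge0// lee_fin powR_ge0.
  apply: le_integral_ge0 => z _.
    by rewrite lee_fin mulr_ge0 ?powR_ge0// ltW// trunc_kernel_gt0.
  rewrite mulrC EFinM muleA; apply: lee_wpmul2r; first by rewrite lee_fin powR_ge0.
  exact: trunc_kernel_le.
rewrite muleCA; apply: lee_wpmul2l => //.
rewrite /pot_measure -ge0_integralZl//; last by move=> z _; exact: kernel_ge0.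
apply: le_integral_ge0 => z _; first by rewrite lee_fin ltW// trunc_kernel_gt0.
exact: trunc_kernel_le.
Qed.

Lemma trunc_pot_ge0 x t : (0 < t)%R -> 0 <= trunc_pot x t.
Proof.
move=> t0; apply: adde_ge0; [|apply: mule_ge0 => //]; apply: integral_ge0 => z _;
  by rewrite lee_fin ?mulr_ge0 ?powR_ge0// ltW// trunc_kernel_gt0.
Qed.

Lemma trunc_pot_scale_le x t s c : (0 < t)%R -> (0 < s)%R -> (0 <= c)%R ->
  (forall z, trunc_kernel x t z <= c * trunc_kernel x s z)%R ->
  trunc_pot x t <= c%:E * trunc_pot x s.
Proof.
move=> t0 s0 c0 hc.
have tk r z : (0 < r)%R -> (0 <= trunc_kernel x r z)%R by move=> r0; rewrite ltW// trunc_kernel_gt0.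
rewrite /trunc_pot [leRHS]ge0_muleDr; last 2 first.
- by apply: integral_ge0 => z _; rewrite lee_fin mulr_ge0 ?powR_ge0// tk.
- by rewrite mule_ge0//; apply: integral_ge0 => z _; rewrite lee_fin tk.
apply: leeD.
  rewrite -ge0_integralZl//; last 2 first.
  - apply/measurable_EFinP; apply: measurable_funM => //; exact: measurable_trunc_kernel.
  - by move=> z _; rewrite lee_fin mulr_ge0 ?powR_ge0// tk.
  apply: le_integral_ge0 => z _; first by rewrite lee_fin mulr_ge0 ?powR_ge0// tk.
  by rewrite -EFinM lee_fin mulrCA; apply: ler_wpM2l; rewrite ?powR_ge0.
rewrite muleCA; apply: lee_wpmul2l => //.
rewrite -ge0_integralZl//; last 2 first.
- apply/measurable_EFinP; exact: measurable_trunc_kernel.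
- by move=> z _; rewrite lee_fin tk.
apply: le_integral_ge0 => z _; first by rewrite lee_fin tk.
by rewrite -EFinM lee_fin.
Qed.

(** The potential is finite at some point because u is real-valued and sigma is
    nonzero; this settles radii t for which that point lies in B_t(x), and a change of
    the radius alters the truncated kernel by a bounded factor only. *)
Lemma trunc_pot_lty x t : (0 < t)%R -> trunc_pot x t < +oo.
Proof.
move=> t0.
have [y hy] : exists y, pot y <= (u y)%:E.
  apply: contrapT => /forallNP hn; move/eqP: sigma0; apply.
  case: hu => N [mN N0 sN]; apply/eqP; rewrite -measure_le0 -N0.
  apply: le_measure; rewrite ?inE//.
  by apply: subset_trans sN => z _ /=; exact: hn.
pose s := Num.max t (rho K x y).
have s0 : (0 < s)%R by rewrite lt_max t0.
have hs : trunc_pot x s < +oo.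
  apply: (@le_lt_trans _ _ ((2 * k)%:E * (u y)%:E)); last by rewrite -EFinM ltry.
  apply: le_trans (lee_wpmul2l _ hy); last by rewrite lee_fin; move: (k1); lra.
  by apply: trunc_pot_le => //; rewrite le_max lexx orbT.
apply: (@le_lt_trans _ _ ((s / t)%:E * trunc_pot x s)).
  apply: trunc_pot_scale_le => //; first by rewrite divr_ge0 ?ltW.
  move=> z; rewrite /trunc_kernel.
  have a1 : (0 < Num.max t (rho K x z))%R by rewrite lt_max t0.
  have a2 : (0 < Num.max s (rho K x z))%R by rewrite lt_max s0.
  have st : (1 <= s / t)%R by rewrite ler_pdivlMr// mul1r le_max lexx.
  rewrite ler_pdivlMr// ler_pdivrMl//.
  have t1 : (t <= Num.max t (rho K x z))%R by rewrite le_max lexx.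
  rewrite ge_max; apply/andP; split.
    by rewrite mulrA ler_pdivlMr// mulrC; apply: ler_wpM2r => //; exact: ltW.
  rewrite -[leLHS]mulr1; apply: ler_pM => //; first exact: rho_ge0.
  by rewrite le_max lexx orbT.
by rewrite lte_mul_pinfty// ?lee_fin ?divr_ge0 ?ltW.
Qed.

(** On B_t(x) the truncated kernel increases by exactly 1/t - 1/2t when the
    truncation radius is halved from 2t to t. *)
Lemma trunc_pot_step x t : (0 < t)%R ->
  trunc_pot x (2 * t)%R +
   ((2 * t)^-1)%:E * \int[sigma]_(z in qball K x t) (u z `^ q)%:E <= trunc_pot x t.
Proof.
move=> t0; have t20 : (0 < 2 * t)%R by move: (k1) (q1); lra.
have tk r z : (0 < r)%R -> (0 <= trunc_kernel x r z)%R by move=> r0; rewrite ltW// trunc_kernel_gt0.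
have mB := measurable_qball hK x t.
have dec z : (trunc_kernel x (2 * t)%R z <= trunc_kernel x t z)%R.
  rewrite lef_pV2 ?posrE ?lt_max ?t0 ?t20//.
  rewrite ge_max !le_max lexx orbT andbT; apply/orP; left; lra.
have mr : measurable_fun [set: borel X] ((fun z => (u z `^ q)%:E) \_ (qball K x t)).
  apply: (measurable_restrictT (fun z : borel X => (u z `^ q)%:E) mB).1.
  by apply/measurable_EFinP; exact: measurable_funTS.
rewrite /trunc_pot addeAC; apply: leeD; last first.
  apply: lee_wpmul2l => //; apply: le_integral_ge0 => z _; rewrite lee_fin; [exact: tk|exact: dec].
rewrite [X in _ + _ * X <= _]integral_mkcond -ge0_integralZl//; last 2 first.
- by move=> z _; apply: erestrict_ge0 => ? _; rewrite lee_fin powR_ge0.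
- by rewrite lee_fin invr_ge0 ltW.
rewrite -ge0_integralD//; last 4 first.
- by move=> z _; rewrite lee_fin mulr_ge0 ?powR_ge0 ?tk.
- by apply/measurable_EFinP; apply: measurable_funM => //; exact: measurable_trunc_kernel.
- move=> z _; rewrite mule_ge0 ?lee_fin ?invr_ge0 ?(ltW t20)//.
  by apply: erestrict_ge0 => ? _; rewrite lee_fin powR_ge0.
- apply: measurable_funeM.
  exact: mr.
apply: le_integral_ge0 => z _.
  apply: adde_ge0; first by rewrite lee_fin mulr_ge0 ?powR_ge0 ?tk.
  apply: mule_ge0; first by rewrite lee_fin invr_ge0 ltW.
  by apply: erestrict_ge0 => ? _; rewrite lee_fin powR_ge0.
rewrite patchE; case: ifPn => [|_]; last first.
  by rewrite mule0 adde0 lee_fin; apply: ler_wpM2l; rewrite ?powR_ge0.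
rewrite inE in_qball// => xz; rewrite -EFinM -EFinD lee_fin.
rewrite mulrC -mulrDl mulrC; apply: ler_wpM2l; rewrite ?powR_ge0//.
rewrite /trunc_kernel !max_l//; last by move: (k1) (q1); lra.
by rewrite le_eqVlt; apply/orP; left; apply/eqP; field; rewrite gt_eqF.
Qed.

(** u >= A(t) / 2k almost everywhere on B_t(x). *)
Lemma trunc_pot_mass x t : (0 < t)%R ->
  ((fine (trunc_pot x t) / (2 * k)) `^ q)%:E * sigma (qball K x t) <=
  \int[sigma]_(z in qball K x t) (u z `^ q)%:E.
Proof.
move=> t0; have mB := measurable_qball hK x t.
have k0 : (0 < 2 * k)%R by move: (k1) (q1); lra.
have Af : trunc_pot x t \is a fin_num by rewrite ge0_fin_numE ?trunc_pot_lty ?trunc_pot_ge0.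
rewrite -integral_cst//; apply: ae_ge0_le_integral => //.
- by move=> z _; rewrite lee_fin powR_ge0.
- by move=> z _; rewrite lee_fin powR_ge0.
- by apply/measurable_EFinP; exact: measurable_funTS.
case: hu => Z [mZ Z0 sZ]; exists Z; split => //; apply: subset_trans sZ.
apply: subsetC => z /= hz; rewrite -/(qball K x t z) in_qball// => xz.
rewrite lee_fin; apply: ge0_ler_powR; rewrite ?nnegrE ?u0//; first by move: (k1) (q1); lra.
  by rewrite divr_ge0 ?fine_ge0 ?trunc_pot_ge0// ltW.
rewrite ler_pdivrMr// -lee_fin fineK// EFinM muleC.
apply: le_trans (trunc_pot_le t0 xz) _.
by apply: lee_wpmul2l => //; rewrite lee_fin ltW.
Qed.

(** Summing the increments of A over the radii 2a / 2^n: each dyadic term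
    sigma(B_(a/2^n)) 2^n / a is bounded by a constant times a difference of consecutive
    values of A^(1-q). *)
Theorem riccati_bound x a m : (0 < a)%R -> (0 < m)%R -> m%:E <= trunc_pot x a ->
  \int[lebesgue_measure]_(t in `]0%R, a[) (sigma (qball K x t) / (t ^+ 2)%:E) <=
  (4 * (2 * k) `^ q / (q - 1) * 2 `^ (q - 1) * m `^ (1 - q))%:E.
Proof.
move=> a0 m0 hm.
pose r n : R := (2 * a / 2 ^+ n)%R.
have pow0 n : (0 < 2 ^+ n :> R)%R by rewrite exprn_gt0.
have r0 n : (0 < r n)%R by rewrite /r divr_gt0// mulr_gt0.
have Af n : trunc_pot x (r n) \is a fin_num by rewrite ge0_fin_numE ?trunc_pot_lty ?trunc_pot_ge0.
pose al n : R := fine (trunc_pot x (r n)).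
have k0 : (0 < 2 * k)%R by move: (k1) (q1); lra.
have rS n : r n = (2 * r n.+1)%R by rewrite /r exprS; field; rewrite gt_eqF.
have stp n : (al n)%:E + ((2 * r n.+1)^-1)%:E * (((al n.+1 / (2 * k)) `^ q)%:E * sigma (qball K x (r n.+1))) <= (al n.+1)%:E.
  rewrite /al !fineK//; apply: le_trans (trunc_pot_step x (r0 n.+1)).
  rewrite -rS leeD2l//; apply: lee_wpmul2l; first by rewrite lee_fin invr_ge0 ltW.
  exact: trunc_pot_mass.
(* A starts at radius 2a, where it is at least half of its value at radius a,
   and increases as the radius decreases. *)
have al_ge : forall n, (m / 2 <= al n)%R.
  elim=> [|n IH].
    rewrite -lee_fin /al fineK// /r expr0 divr1.
    have h : trunc_pot x a <= 2%:E * trunc_pot x (2 * a)%R.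
      apply: trunc_pot_scale_le => //; first by move: (k1) (q1); lra.
      move=> z; rewrite /trunc_kernel.
      have a1 : (0 < Num.max a (rho K x z))%R by rewrite lt_max a0.
      have a2 : (0 < Num.max (2 * a) (rho K x z))%R by rewrite lt_max mulr_gt0.
      rewrite ler_pdivlMr// ler_pdivrMl//.
      have ta : (a <= Num.max a (rho K x z))%R by rewrite le_max lexx.
      have tr : (rho K x z <= Num.max a (rho K x z))%R by rewrite le_max lexx orbT.
      by have := rho_ge0 hK x z; rewrite ge_max => rz; apply/andP; split; lra.
    have := le_trans hm h; have := Af 0%N; rewrite /r expr0 divr1 => Tf.
    by rewrite -(fineK Tf) -EFinM !lee_fin => ?; lra.
  apply: le_trans IH _; rewrite -lee_fin; apply: le_trans (stp n).
  by rewrite leeDl// !mule_ge0 ?lee_fin ?invr_ge0 ?mulr_ge0 ?powR_ge0// ltW.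
have al0 n : (0 < al n)%R by apply: lt_le_trans (al_ge n); lra.
pose D : R := (2 * (2 * k) `^ q / (q - 1))%R.
have D0 : (0 <= D)%R by rewrite divr_ge0 ?mulr_ge0 ?powR_ge0//; move: (k1) (q1); lra.
have bn n : sigma (qball K x (a / 2 ^+ n)) * (2 ^+ n / a)%:E <=
   (D * (al n `^ (1 - q) - al n.+1 `^ (1 - q)))%:E.
  have -> : (a / 2 ^+ n = r n.+1)%R by rewrite /r exprS; field; rewrite gt_eqF.
  have := stp n; set S := sigma _.
  have S0 : 0 <= S by exact: measure_ge0.
  set c := ((al n.+1 / (2 * k)) `^ q)%R.
  have c0 : (0 < c)%R by rewrite powR_gt0// divr_gt0.
  move=> h.
  (* An infinite mass would make the next value of A infinite. *)
  have Sf : S \is a fin_num.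
    rewrite ge0_fin_numE// ltey; apply/negP => /eqP Sy.
    move: h; rewrite Sy gt0_muley ?lte_fin// gt0_muley ?lte_fin ?invr_gt0 ?mulr_gt0//.
  move: h; rewrite -(fineK Sf) -!EFinM -EFinD !lee_fin.
  set s := fine S => h.
  have s0 : (0 <= s)%R by rewrite fine_ge0.
  have -> : (2 ^+ n / a = (r n.+1)^-1)%R by rewrite /r exprS; field; rewrite !gt_eqF.
  have hd := @powR_decrement R (al n) (al n.+1) q q1 (al0 n) (al0 n.+1).
  have cE : (c = al n.+1 `^ q / (2 * k) `^ q)%R.
    rewrite /c powRM ?invr_ge0 ?(ltW k0) ?(ltW (al0 _))//.
    by rewrite -(powR_inv1 (ltW k0)) -powRrM mulN1r powRN.
  have K0 : (0 < (2 * k) `^ q)%R by rewrite powR_gt0.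
  have B0 : (0 < al n.+1 `^ q)%R by rewrite powR_gt0.
  apply: (@le_trans _ _ (2 * (2 * k) `^ q * ((al n.+1 - al n) * al n.+1 `^ (- q)))%R).
    have {}h : (s / r n.+1 * c / 2 <= al n.+1 - al n)%R.
      rewrite lerBrDl; apply: le_trans h; rewrite lerD2l le_eqVlt; apply/orP; left.
      by apply/eqP; field; rewrite gt_eqF.
    rewrite powRN mulrA ler_pdivlMr//.
    move: h; rewrite cE -(ler_pM2r K0) => h.
    have -> : (2 * (2 * k) `^ q * (al n.+1 - al n) = 2 * ((al n.+1 - al n) * (2 * k) `^ q))%R by ring.
    apply: le_trans (ler_wpM2l _ h); last by [].
    rewrite le_eqVlt; apply/orP; left; apply/eqP; field.
    by rewrite !gt_eqF.
  rewrite /D.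
  have -> : (2 * (2 * k) `^ q / (q - 1) * (al n `^ (1 - q) - al n.+1 `^ (1 - q)) =
     2 * (2 * k) `^ q * ((al n `^ (1 - q) - al n.+1 `^ (1 - q)) / (q - 1)))%R by ring.
  by apply: ler_wpM2l => //; rewrite mulr_ge0// ltW.
apply: (@le_trans _ _ (2%:E * (D * (m / 2) `^ (1 - q))%:E)).
  apply: integral_small_radii => //.
  - move=> s t st; apply: le_measure; rewrite ?inE; [exact: measurable_qball..|].
    by move=> z; rewrite !in_qball// => /le_trans; exact.
  - move=> n; apply: le_trans; first by apply: lee_sum => i _; exact: bn.
    rewrite sumEFin lee_fin -mulr_sumr; apply: ler_wpM2l => //.
    have -> : (\sum_(0 <= i < n) (al i `^ (1 - q) - al i.+1 `^ (1 - q)) =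
        al 0%N `^ (1 - q) - al n `^ (1 - q))%R.
      elim: n => [|n IH]; first by rewrite big_nil subrr.
      by rewrite big_nat_recr//= IH; ring.
    have : (0 <= al n `^ (1 - q))%R by exact: powR_ge0.
    suff : (al 0%N `^ (1 - q) <= (m / 2) `^ (1 - q))%R by move: (k1) (q1); lra.
    rewrite -opprB !powRN lef_pV2 ?posrE ?powR_gt0 ?divr_gt0//.
    apply: ge0_ler_powR; rewrite ?nnegrE ?(ltW (al0 _)) ?divr_ge0 ?(ltW m0)//.
    by move: (k1) (q1); lra.
rewrite -EFinM lee_fin (@powRM R m) ?invr_ge0 ?(ltW m0)//.
have -> : (2^-1 `^ (1 - q) = 2 `^ (q - 1) :> R)%R.
  by rewrite -[in LHS](powR_inv1 (ler0n R 2)) -powRrM mulN1r opprB.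
rewrite /D.
by rewrite le_eqVlt; apply/orP; left; apply/eqP; field; move: (q1); lra.
Qed.

End riccati.

(** * A large set on which a trace inequality holds *)

Section conjugate.
Context {R : realType}.
Variables (p q : R).
Hypothesis q1 : 1 < q.
Hypothesis pq : p^-1 + q^-1 = 1.

Lemma conjugate_gt1 : 1 < p.
Proof.
have q0 : 0 < q by exact: lt_trans q1.
have pV : p^-1 = 1 - q^-1 by rewrite -pq addrK.
have qV1 : q^-1 < 1 by rewrite invf_lt1.
have qV0 : 0 < q^-1 by rewrite invr_gt0.
have pV0 : 0 < p^-1 by rewrite pV subr_gt0.
have p0 : 0 < p by rewrite -invr_gt0.
by rewrite -invf_lt1// pV; lra.
Qed.

Lemma conjugate_subM : (p - 1) * (q - 1) = 1.
Proof.
have q0 : q != 0 by rewrite gt_eqF// (lt_trans _ q1).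
have p0 : p != 0 by rewrite gt_eqF// (lt_trans _ conjugate_gt1).
have : p + q = p * q.
  have := congr1 (fun x => x * (p * q)) pq; rewrite mul1r => <-.
  by field; rewrite p0 q0.
move=> h; have -> : (p - 1) * (q - 1) = p * q - (p + q) + 1 by ring.
by rewrite h subrr add0r.
Qed.

Let p0 : 0 < p. Proof. exact: lt_trans conjugate_gt1. Qed.
Let q0 : 0 < q. Proof. exact: lt_trans q1. Qed.

Lemma conjugate_divE : q / p = q - 1.
Proof.
have -> : p^-1 = 1 - q^-1 by rewrite -pq addrK.
by field; rewrite gt_eqF.
Qed.

Lemma conjugate_divE' : p / q = p - 1.
Proof.
have -> : q^-1 = 1 - p^-1 by rewrite -pq addrC addKr.
by field; rewrite gt_eqF.
Qed.

(** Young's inequality for the factors l g w^(-1/p) and w^(1/p) / l of g. *)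
Lemma young_weighted (g w l : R) : 0 <= g -> 0 < w -> 0 < l ->
  g <= l `^ p / p * (g `^ p / w) + l `^ (- q) / q * w `^ (q - 1).
Proof.
move=> g0 w0 l0; have wp0 : 0 < w `^ (p^-1) by rewrite powR_gt0.
have a0 : 0 <= l * g / w `^ (p^-1) by rewrite divr_ge0 ?mulr_ge0 ?(ltW l0) ?(ltW wp0).
have b0 : 0 <= w `^ (p^-1) / l by rewrite divr_ge0 ?(ltW l0) ?(ltW wp0).
have := conjugate_powR a0 b0 p0 q0 pq.
have -> : l * g / w `^ (p^-1) * (w `^ (p^-1) / l) = g by field; rewrite !gt_eqF.
rewrite (@powRM _ (l * g)) ?mulr_ge0 ?invr_ge0 ?(ltW wp0) ?(ltW l0)//.
rewrite powRM ?(ltW l0)//.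
rewrite (@powRM _ _ l^-1) ?invr_ge0 ?(ltW wp0) ?(ltW l0)//.
rewrite -(powR_inv1 (ltW wp0)) -(powR_inv1 (ltW l0)) -!powRrM !mulN1r.
rewrite mulrN mulVf ?gt_eqF// (mulrC p^-1 q) conjugate_divE.
rewrite powR_inv1 ?(ltW w0)// => h; apply: le_trans h _.
by rewrite le_eqVlt; apply/orP; left; apply/eqP; ring.
Qed.

(** Optimising over the scaling parameter l turns the sum of Young's inequality into
    the product of Hoelder's; a proof in this form applies to kernels with infinite
    values. *)
Lemma hoelder_of_young (V U : \bar R) (h : R) : 0 < h -> (0 <= V)%E -> (0 <= U)%E ->
  (forall l : R, 0 < l -> (V <= (l `^ p / p)%:E * U + (l `^ (- q) / q * h)%:E)%E) ->
  (V `^ p <= (h `^ (p - 1))%:E * U)%E.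
Proof.
move=> h0 V0; have hp : 0 < h `^ (p - 1) by rewrite powR_gt0.
case: U => [u||]// u0 hV; last by rewrite gt0_muley ?lte_fin// leey.
move: u0; rewrite lee_fin => u0.
have hV' (l : R) : 0 < l -> (V <= (l `^ p / p * u + l `^ (- q) / q * h)%:E)%E.
  by move=> /hV; rewrite -EFinM -EFinD.
have Vf : V \is a fin_num.
  by rewrite ge0_fin_numE//; apply: le_lt_trans (hV' _ ltr01) (ltry _).
move: V0 hV'; rewrite -(fineK Vf); set v := fine V; rewrite lee_fin => v0 hv.
rewrite -EFinM poweR_EFin lee_fin.
suff hs : forall s, u < s -> v `^ p <= h `^ (p - 1) * s.
  rewrite -ler_pdivrMl//; apply/ler_addgt0Pr => e e0.
  by rewrite ler_pdivrMl//; apply: hs; rewrite ltrDl.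
move=> s us; have s0 : 0 < s by exact: le_lt_trans us.
have hs0 : 0 < h / s by rewrite divr_gt0.
(* The minimiser of l^p s / p + l^(-q) h / q, since p + q = p q. *)
pose l := (h / s) `^ ((p * q)^-1).
have l0 : 0 < l by rewrite powR_gt0.
have lp : l `^ p = (h / s) `^ (q^-1).
  by rewrite -powRrM invfM (mulrC p^-1) -mulrA mulVf ?gt_eqF// mulr1.
have lq : l `^ (- q) = (h / s) `^ (- p^-1).
  by rewrite -powRrM invfM mulrN -mulrA mulVf ?gt_eqF// mulr1.
have vw : v <= h `^ (q^-1) * s `^ (p^-1).
  have := hv l l0; rewrite lee_fin => hvl; apply: le_trans hvl _.
  apply: (@le_trans _ _ (l `^ p / p * s + l `^ (- q) / q * h)).
    rewrite lerD2r; apply: ler_wpM2l; last exact: ltW.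
    by rewrite divr_ge0 ?powR_ge0// ltW.
  rewrite lp lq !powRM ?invr_ge0 ?(ltW h0) ?(ltW s0)//.
  rewrite -!(powR_inv1 (ltW s0)) -!powRrM !mulN1r opprK.
  have e1 : s `^ (- q^-1) * s = s `^ (p^-1).
    rewrite -[X in _ * X](powRr1 (ltW s0)) -powRD; last by rewrite (gt_eqF s0) implybT.
    by congr (_ `^ _); rewrite -pq addrC addrK.
  have e2 : h `^ (- p^-1) * h = h `^ (q^-1).
    rewrite -[X in _ * X](powRr1 (ltW h0)) -powRD; last by rewrite (gt_eqF h0) implybT.
    by congr (_ `^ _); rewrite -pq addKr.
  have -> : h `^ q^-1 * s `^ (- q^-1) / p * s + h `^ (- p^-1) * s `^ p^-1 / q * h =
     h `^ q^-1 * (s `^ (- q^-1) * s) / p + (h `^ (- p^-1) * h) * s `^ p^-1 / q by ring.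
  rewrite e1 e2 -mulrDr pq mulr1//.
apply: (@le_trans _ _ ((h `^ (q^-1) * s `^ (p^-1)) `^ p)).
  by apply: ge0_ler_powR; rewrite ?nnegrE ?mulr_ge0 ?powR_ge0// ltW.
rewrite powRM ?powR_ge0// -!powRrM mulVf ?gt_eqF// powRr1 ?(ltW s0)//.
by rewrite mulrC (mulrC q^-1) conjugate_divE' mulrC.
Qed.

Section two_weight.
Local Open Scope ereal_scope.
Context d1 d2 (Y : measurableType d1) (Z : measurableType d2).
Variables (m : {sigma_finite_measure set Y -> \bar R})
  (sigma : {sigma_finite_measure set Z -> \bar R}).
Variables (k : Y * Z -> \bar R) (P : Z -> R) (Q Mm : R).
Hypothesis mk : measurable_fun setT k.
Hypothesis k0 : forall z, 0 <= k z.
Hypothesis mP : measurable_fun setT P.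
Hypothesis P0 : forall z, (0 < P z)%R.
Hypothesis kP : forall z, \int[m]_y k (y, z) = (P z)%:E.
Hypothesis Mm0 : (0 < Mm)%R.
Hypothesis mMm : m setT = Mm%:E.
Hypothesis Q0 : (0 < Q)%R.
Hypothesis PQ : \int[sigma]_z (P z `^ q)%:E <= Q%:E.

Let weighted (w : Z -> R) y := \int[sigma]_z (k (y, z) * (w z)%:E).

Let mkw (w : Z -> R) : measurable_fun setT w ->
  measurable_fun setT (fun yz : Y * Z => k yz * (w yz.2)%:E).
Proof.
move=> mw; apply: emeasurable_funM => //.
apply/measurable_EFinP; exact: (measurableT_comp mw).
Qed.

Let kw0 (w : Z -> R) : (forall z, 0 <= w z)%R -> forall yz : Y * Z, 0 <= k yz * (w yz.2)%:E.
Proof. by move=> w0 yz; rewrite mule_ge0 ?lee_fin. Qed.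

Let mweighted (w : Z -> R) : measurable_fun setT w -> (forall z, 0 <= w z)%R ->
  measurable_fun setT (weighted w).
Proof.
move=> mw w0.
exact: (measurable_fun_fubini_tonelli_F (fun yz : Y * Z => k yz * (w yz.2)%:E) (mkw mw) (kw0 w0)).
Qed.

Let int_weighted (w : Z -> R) : measurable_fun setT w -> (forall z, 0 <= w z)%R ->
  \int[m]_y weighted w y = \int[sigma]_z (P z * w z)%:E.
Proof.
move=> mw w0.
rewrite (fubini_tonelli (fun yz : Y * Z => k yz * (w yz.2)%:E) (mkw mw) (kw0 w0)).
apply: eq_integral => z _ /=.
under eq_integral do rewrite muleC.
rewrite ge0_integralZl ?kP//; first by rewrite EFinM muleC.
- exact: measurableT_comp mk (measurable_pair2 _).
- by rewrite lee_fin.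
Qed.

(** Let P be the potential of m and H that of P^(q-1) sigma.  By Tonelli the integral
    of H against m is that of P^q against sigma, so H <= 2 Q / Mm =: h on a set G with
    at least half of the mass.  There Hoelder's inequality with weight P gives
    (int k g dsigma)^p <= h^(p-1) int k (g^p / P) dsigma, and integrating in m the
    factor P cancels. *)
Lemma two_weight_large_set : exists G : set Y, [/\ measurable G,
  (Mm / 2)%:E <= m G &
  forall g : Z -> R, measurable_fun setT g -> (forall z, 0 <= g z)%R ->
  \int[m]_(y in G) ((\int[sigma]_z (k (y, z) * (g z)%:E)) `^ p) <=
  ((2 * Q / Mm) `^ (p - 1))%:E * \int[sigma]_z (g z `^ p)%:E].
Proof.
pose h : R := (2 * Q / Mm)%R.
have h0 : (0 < h)%R by rewrite divr_gt0// mulr_gt0.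
pose w z := (P z `^ (q - 1))%R.
have mw : measurable_fun setT w by exact: (measurableT_comp (measurable_powR (q - 1)) mP).
have w0 z : (0 <= w z)%R by exact: powR_ge0.
pose H := weighted w.
have mH : measurable_fun setT H by exact: mweighted.
have H0 y : 0 <= H y by apply: integral_ge0 => z _; rewrite mule_ge0 ?lee_fin.
pose G := setT `&` [set y | H y <= h%:E].
have mG : measurable G by exact: emeasurable_fun_infty_c.
have intH : \int[m]_y H y <= Q%:E.
  rewrite /H int_weighted//; apply: le_trans PQ; rewrite le_eqVlt; apply/orP; left.
  apply/eqP; apply: eq_integral => z _; congr (_%:E).
  rewrite /w -[X in (X * _)%R](powRr1 (ltW (P0 z))) -powRD ?(gt_eqF (P0 z)) ?implybT//.
  by congr (_ `^ _)%R; rewrite addrC subrK.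
(* Chebyshev's inequality. *)
have mGC : m (~` G) <= (Mm / 2)%:E.
  have : h%:E * m (~` G) <= Q%:E.
    apply: le_trans intH; rewrite -integral_cst//; last exact: measurableC.
    apply: (@le_trans _ _ (\int[m]_(y in ~` G) H y)).
      apply: le_integral_ge0 => y; first by rewrite lee_fin ltW.
      by rewrite /G setTI /= => /negP; rewrite -ltNge => /ltW.
    by apply: ge0_subset_integral => //; exact: measurableC.
  rewrite -lee_pdivlMl// => hm; apply: le_trans hm _; rewrite -EFinM lee_fin /h.
  by rewrite le_eqVlt; apply/orP; left; apply/eqP; field; rewrite !gt_eqF.
exists G; split => //.
  have : m G + m (~` G) = Mm%:E.
    rewrite -measureU ?setICr//; first by rewrite setUv.
    exact: measurableC.
  have Gf : m G \is a fin_num.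
    rewrite ge0_fin_numE//; apply: le_lt_trans (ltry Mm); rewrite -mMm.
    by apply: le_measure; rewrite ?inE.
  have GCf : m (~` G) \is a fin_num by rewrite ge0_fin_numE//; apply: le_lt_trans mGC (ltry _).
  move: mGC; rewrite -(fineK Gf) -(fineK GCf) -EFinD !lee_fin => h1 [] h2.
  by move: h1 h2; lra.
move=> g mg g0.
pose gp z := (g z `^ p / P z)%R.
have mgp : measurable_fun setT gp.
  apply: measurable_funM; first exact: (measurableT_comp (measurable_powR p) mg).
  rewrite (_ : (fun x => _) = (fun z => P z `^ (-1))%R); last first.
    by apply/funext => z; rewrite powR_inv1// ltW.
  exact: (measurableT_comp (measurable_powR (-1)) mP).
have gp0 z : (0 <= gp z)%R by rewrite divr_ge0 ?powR_ge0// ltW.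
have U0 y : 0 <= weighted gp y by apply: integral_ge0 => z _; rewrite mule_ge0 ?lee_fin.
have V0 y : 0 <= weighted g y by apply: integral_ge0 => z _; rewrite mule_ge0 ?lee_fin.
apply: (@le_trans _ _ (\int[m]_(y in G) ((h `^ (p - 1))%:E * weighted gp y))).
  apply: le_integral_ge0 => y; first by move=> _; exact: poweR_ge0.
  rewrite /G setTI /= => Hy.
  apply: hoelder_of_young => //; [exact: V0|].
  move=> l l0.
  have lp0 : (0 <= l `^ p / p)%R by rewrite divr_ge0 ?powR_ge0// ltW.
  have lq0 : (0 <= l `^ (- q) / q)%R by rewrite divr_ge0 ?powR_ge0// ltW.
  apply: (@le_trans _ _ ((l `^ p / p)%:E * weighted gp y + (l `^ (- q) / q)%:E * H y)); last first.
    by apply: leeD => //; rewrite (EFinM _ h); apply: lee_wpmul2l => //; rewrite lee_fin.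
  have mky : measurable_fun setT (fun z => k (y, z)) by exact: measurableT_comp mk (measurable_pair1 _).
  rewrite /H /weighted -!ge0_integralZl//; last 4 first.
  - by apply: emeasurable_funM => //; exact/measurable_EFinP.
  - by move=> z _; rewrite mule_ge0 ?lee_fin.
  - by apply: emeasurable_funM => //; exact/measurable_EFinP.
  - by move=> z _; rewrite mule_ge0 ?lee_fin.
  rewrite -ge0_integralD//; last 4 first.
  - by move=> z _; rewrite !mule_ge0 ?lee_fin.
  - by apply: measurable_funeM; apply: emeasurable_funM => //; exact/measurable_EFinP.
  - by move=> z _; rewrite !mule_ge0 ?lee_fin.
  - by apply: measurable_funeM; apply: emeasurable_funM => //; exact/measurable_EFinP.
  apply: le_integral_ge0 => z _; first by rewrite mule_ge0 ?lee_fin.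
  rewrite muleCA [X in _ + X]muleCA -ge0_muleDr; last 2 first.
  - by rewrite -EFinM lee_fin mulr_ge0.
  - by rewrite -EFinM lee_fin mulr_ge0.
  apply: lee_wpmul2l => //; rewrite -!EFinM -EFinD lee_fin.
  exact: young_weighted.
apply: (@le_trans _ _ (\int[m]_y ((h `^ (p - 1))%:E * weighted gp y))).
  apply: ge0_subset_integral => //.
    by apply: measurable_funeM; exact: mweighted.
  by move=> y _; rewrite mule_ge0 ?lee_fin ?powR_ge0.
rewrite ge0_integralZl//; last 2 first.
- exact: mweighted.
- by rewrite lee_fin powR_ge0.
apply: lee_wpmul2l; first by rewrite lee_fin powR_ge0.
rewrite int_weighted//; rewrite le_eqVlt; apply/orP; left; apply/eqP.
apply: eq_integral => z _; congr (_%:E); rewrite /gp mulrC -mulrA mulVf ?mulr1//.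
by rewrite gt_eqF.
Qed.

End two_weight.
End conjugate.

(** * Stable measures *)

Section stable.
Context {R : realType} {X : pmetricType R}.
Variable K : X -> X -> \bar R.
Hypothesis hK : quasi_metric_kernel K.
Variables (k : R).
Hypothesis k1 : 1 <= k.
Hypothesis tri : forall x y z, rho K x y <= k * (rho K x z + rho K z y).
Variable mu : {measure set (borel X) -> \bar R}.
Hypothesis hst : stable K mu.
Hypothesis mu0 : mu setT != 0%E.

Let k0 : 0 < k. Proof. exact: lt_le_trans ltr01 k1. Qed.

Let mB x a := measurable_qball hK x a.

Lemma sub_qball x y a b : k * (rho K x y + a) <= b -> qball K y a `<=` qball K x b.
Proof.
move=> ab z; rewrite !in_qball// => yz; apply: le_trans (tri x z y) _.
by apply: le_trans ab; rewrite ler_pM2l// lerD2l.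
Qed.

Lemma stable_qball_lty x a : (mu (qball K x a) < +oo)%E.
Proof.
apply: hst.1 => //; apply: (@le_lt_trans _ _ (k * (a + a))%:E); last exact: ltry.
apply: ge_ereal_sup => _ [[y z] [/= xy xz] <-] /=.
move: xy xz; rewrite -/(qball K x a y) -/(qball K x a z) !in_qball// => xy xz.
rewrite qrhoE// lee_fin; apply: le_trans (tri y z x) _.
by rewrite ler_pM2l// rho_sym// lerD.
Qed.

Lemma qball_cover x : \bigcup_n (qball K x n%:R) = setT.
Proof.
apply/seteqP; split => // y _; exists (Num.truncn (rho K x y)).+1 => //.
by rewrite in_qball// ltW// truncnS_gt.
Qed.

Lemma stable_qball_doubling : exists2 C : R, 1 <= C &
  forall x s, 0 < s -> (mu (qball K x (2 * s)) <= C%:E * mu (qball K x s))%E.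
Proof.
have [_ [C [dl [C0 dl0 h]]]] := hst; exists (C + 1); first by rewrite lerDr ltW.
move=> x s s0; have s2 : 0 < s / 2 by rewrite divr_gt0.
have ss : s / 2 < s by lra.
apply: le_trans (h x _ s s2 ss).1 _; apply: lee_wpmul2r => //.
by rewrite lee_fin lerDl.
Qed.

Lemma stable_qball_iter C : 1 <= C ->
  (forall x s, 0 < s -> (mu (qball K x (2 * s)) <= C%:E * mu (qball K x s))%E) ->
  forall n x s, 0 < s -> (mu (qball K x (2 ^+ n * s)) <= (C ^+ n)%:E * mu (qball K x s))%E.
Proof.
move=> C1 h n x s s0; elim: n => [|n IH]; first by rewrite !expr0 mul1r mul1e.
rewrite exprS -mulrA; apply: le_trans (h _ _ _) _; first by rewrite mulr_gt0// exprn_gt0.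
rewrite exprS EFinM -muleA; apply: lee_wpmul2l => //.
by rewrite lee_fin (le_trans _ C1).
Qed.

(** A ball of measure zero would, by doubling, be contained in balls of measure zero
    exhausting X. *)
Lemma stable_qball_gt0 x a : 0 < a -> (0 < mu (qball K x a))%E.
Proof.
move=> a0; rewrite lt_def measure_ge0 andbT; apply/eqP => ma0.
move/eqP: mu0; apply; have [C C1 dbl] := stable_qball_doubling.
have h n : mu (qball K x (2 ^+ n * a)) = 0%E.
  apply/eqP; rewrite -measure_le0; apply: le_trans (stable_qball_iter C1 dbl n x a0) _.
  by rewrite ma0 mule0.
apply/eqP; rewrite -measure_le0.
apply: (@le_trans _ _ (\sum_(n <oo) mu (qball K x (2 ^+ n * a)))%E); last first.
  by rewrite eseries0// => i _ _; rewrite h.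
apply: measure_sigma_subadditive => // y _.
exists (Num.truncn (rho K x y / a)).+1 => //; rewrite in_qball// -ler_pdivrMr//.
apply: le_trans (ltW (truncnS_gt _)) _.
by rewrite -natrX ler_nat ltnW// ltn_expl.
Qed.

(** A maximal disjoint family of balls of radius s is countable, since they have
    positive mass, and by maximality every point is within 2 k s of one of the
    centres. *)
Lemma stable_dense : exists d : nat -> X, forall y e, 0 < e -> exists n, rho K y (d n) <= e.
Proof.
have net (m : nat) : exists2 D : set X, countable D &
    forall y, exists2 x, D x & rho K y x <= 2 * k / m.+1%:R.
  pose s : R := m.+1%:R^-1; have s0 : 0 < s by rewrite invr_gt0.
  have [D [_ tD maxD]] := @ex_maximal_disjoint_subcollection _ _ (fun x => qball K x s) setT.
  exists D.
    pose x0 : X := point.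
    have -> : D = \bigcup_n (D `&` qball K x0 n%:R).
      by rewrite -setI_bigcupr qball_cover setIT.
    apply: bigcup_countable => // n _.
    apply: (@countable_disjoint_pos_measure _ _ _ mu _ _ (fun x => qball K x s)
        (qball K x0 (k * (n%:R + s)))) => //.
    - exact: stable_qball_lty.
    - by apply: sub_trivIset tD; exact: subIsetl.
    - move=> x [_]; rewrite in_qball// => x0x; apply: sub_qball.
      by rewrite ler_pM2l// lerD2r.
    - by move=> x _; exact: stable_qball_gt0.
  move=> y; apply: contrapT => hy.
  have Dy : ~ D y.
    move=> Dy; apply: hy; exists y => //.
    have [z Bz] : qball K y s !=set0.
      apply/set0P/eqP => B0; have := stable_qball_gt0 y s0; rewrite B0 measure0.
      by rewrite ltxx.
    move: Bz; rewrite in_qball// => yz; apply: le_trans (tri y y z) _.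
    by rewrite (rho_sym hK z y) -/s; have := ler_wpM2l (ltW k0) yz; lra.
  apply: (maxD (D `|` [set y])).
  - split; first exact: subsetUl.
    by move=> /(_ y (or_intror erefl)).
  - exact: subsetT.
  - have key x : D x -> qball K x s `&` qball K y s !=set0 -> False.
      move=> Dx [z []]; rewrite !in_qball// => xz yz; apply: hy; exists x => //.
      apply: le_trans (tri y x z) _; rewrite (rho_sym hK z x) -/s.
      by have := ler_wpM2l (ltW k0) yz; have := ler_wpM2l (ltW k0) xz; lra.
    move=> i j [Di|->] [Dj|->]//.
    + by apply: tD.
    + by move/key => /(_ Di).
    + by rewrite setIC => /key => /(_ Dj).
pose D m := xget set0 [set D : set X | countable D /\
    forall y, exists2 x, D x & rho K y x <= 2 * k / m.+1%:R].
have DP m : countable (D m) /\ forall y, exists2 x, D m x & rho K y x <= 2 * k / m.+1%:R.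
  have [E cE hE] := net m.
  exact: (@xgetPex _ set0 [set D : set X | countable D /\
    forall y, exists2 x, D x & rho K y x <= 2 * k / m.+1%:R] (ex_intro _ E (conj cE hE))).
have cD : countable (\bigcup_m D m) by apply: bigcup_countable => // m _; exact: (DP m).1.
have [D0|[f]] := pfcard_geP cD.
  have [x Dx _] := (DP 0%N).2 point.
  by have : (\bigcup_m D m) x by [exists 0%N]; rewrite D0.
exists f => y e e0.
have [x Dx yx] := (DP (Num.truncn (2 * k / e))).2 y.
have [n _ fn] : (f @` setT) x by apply: surj; exists (Num.truncn (2 * k / e)).
exists n; rewrite fn; apply: le_trans yx _.
rewrite ler_pdivrMr// [leRHS]mulrC -ler_pdivrMr//.
exact: ltW (truncnS_gt _).
Qed.

(** Far from the ball, K(z,.) is at most 2k / rho(x,z) on it.  Near it, the growth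
    exponent 1 + dl > 1 makes the dyadic decomposition of the potential around z a
    convergent geometric series, comparable to its first term. *)
Lemma stable_potential : exists2 M : R, 0 < M & forall x a z, 0 < a ->
  (\int[mu]_(y in qball K x a) K z y <=
    (M * fine (mu (qball K x a)) / Num.max a (rho K x z))%:E)%E.
Proof.
have [C C1 dbl] := stable_qball_doubling.
have [_ [C' [dl [C'0 dl0 hC']]]] := hst.
(* The ratio of the geometric series. *)
pose th : R := 2^-1 `^ dl.
have th0 : 0 <= th by exact: powR_ge0.
have th1 : th < 1.
  rewrite /th; have : 2^-1 `^ dl < 1 `^ dl; last by rewrite powR1.
  by apply: gt0_ltr_powR; rewrite ?nnegrE//; lra.
have [N hN] : exists N : nat, 5 * k ^+ 3 <= 2 ^+ N.
  exists (Num.truncn (5 * k ^+ 3)).+1; apply: le_trans (ltW (truncnS_gt _)) _.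
  by rewrite -natrX ler_nat ltnW// ltn_expl.
pose D := (C' + 1) * C ^+ N / (1 - th).
have D0 : 0 < D.
  by rewrite divr_gt0 ?subr_gt0// mulr_gt0 ?exprn_gt0 ?addr_gt0// (lt_le_trans ltr01).
exists (2 * k + 2 * D); first by apply: addr_gt0; apply: mulr_gt0.
move=> x a z a0; set m := fine _.
have mf : mu (qball K x a) \is a fin_num by rewrite ge0_fin_numE// stable_qball_lty.
have m0 : 0 <= m by rewrite fine_ge0.
have [far|near] := ltP (2 * k * a) (rho K x z).
  have r0 : 0 < rho K x z by apply: lt_trans far; rewrite !mulr_gt0.
  have ra : a <= rho K x z.
    apply: le_trans (ltW far); rewrite -[leLHS]mul1r ler_pM2r//; move: (k1); lra.
  rewrite max_r//.
  apply: (@le_trans _ _ (\int[mu]_(y in qball K x a) (2 * k / rho K x z)%:E)%E).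
    apply: le_integral_ge0 => y; first by move=> _; exact: kernel_ge0.
    rewrite in_qball// => xy.
    rewrite -[(2 * k / _)]invrK; apply: kernel_leV => //.
      by rewrite invr_gt0 divr_gt0 ?mulr_gt0.
    rewrite invf_div ler_pdivrMr ?mulr_gt0//.
    have := tri x z y; rewrite (rho_sym hK y z).
    have : k * rho K x y <= k * a by rewrite ler_pM2l.
    by move: far; lra.
  rewrite integral_cst// -(fineK mf) -/m -EFinM lee_fin.
  rewrite mulrAC; apply: ler_wpM2r; first by rewrite invr_ge0 ltW.
  by apply: ler_wpM2r => //; rewrite lerDl mulr_ge0// ltW.
(* A radius such that B_a(x) is contained in B_r(z). *)
pose r := 3 * k ^+ 2 * a.
have r0 : 0 < r by rewrite !mulr_gt0// exprn_gt0.
have pow0 n : 0 < 2 ^+ n :> R by rewrite exprn_gt0.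
have rho_r y : qball K x a y -> rho K z y <= r.
  rewrite in_qball// => xy; apply: le_trans (tri z y x) _; rewrite (rho_sym hK z x) /r.
  have -> : 3 * k ^+ 2 * a = k * (2 * k * a + k * a) by ring.
  rewrite ler_pM2l// lerD//; apply: le_trans xy _.
  by rewrite -[leLHS]mul1r ler_pM2r.
pose g j (y : X) : \bar R := ((2 ^+ j.+1 / r)%:E * (\1_(qball K z (r / 2 ^+ j)) y)%:E)%E.
have g0 j y : (0 <= g j y)%E by rewrite mule_ge0// lee_fin divr_ge0// ltW.
have c0 j : 0 <= 2 ^+ j.+1 / r by rewrite divr_ge0// ltW.
apply: (@le_trans _ _ (\int[mu]_(y in qball K x a) (\sum_(j <oo) g j y))%E).
  apply: le_integral_ge0 => y; first by move=> _; exact: kernel_ge0.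
  move=> xy; have zr := rho_r _ xy.
  have := rho_ge0 hK z y; rewrite le_eqVlt => /orP[/eqP/esym zy0|zy0].
    rewrite kernel_rho_eq0//.
    (* Where K is infinite, y lies in all the balls and the series diverges. *)
    have hj j : ((2 ^+ j.+1 / r)%:E <= \sum_(j <oo) g j y)%E.
      apply: le_trans (nneseries_ge_term j (g0 ^~ y)).
      by rewrite /g indicE mem_set ?mule1// in_qball// zy0 divr_ge0// ltW.
    have := nneseries_ge0 (fun j _ _ => g0 j y) : (0 <= \sum_(j <oo) g j y)%E.
    move: hj; case: (\sum_(j <oo) g j y)%E => [s||]// hj _.
    have := hj (Num.truncn (s * r)); rewrite lee_fin ler_pdivrMr// leNgt => /negP[].
    apply: lt_trans (truncnS_gt _) _; by rewrite -natrX ltr_nat ltn_expl.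
  have [j /andP[j1 j2]] : exists j : nat, 2 ^+ j <= r / rho K z y < 2 ^+ j.+1.
    by apply: dyadic_bracket; rewrite ler_pdivlMr// mul1r.
  apply: le_trans (nneseries_ge_term j (g0 ^~ y)).
  rewrite /g indicE mem_set ?mule1; last first.
    by rewrite in_qball// ler_pdivlMr// mulrC -ler_pdivlMr.
  rewrite kernel_rho_gt0// lee_fin ler_pdivlMr// mulrC.
  exact: ltW.
rewrite integral_nneseries//; last first.
  by move=> j; apply: measurable_funeM; apply/measurable_EFinP; exact: measurable_indic.
apply: lime_le; first by apply: is_cvg_nneseries => j _ _; exact: integral_ge0.
apply: nearW => n.
have mr : (mu (qball K z r) <= (C ^+ N * m)%:E)%E.
  apply: (@le_trans _ _ (mu (qball K x (2 ^+ N * a)))).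
    apply: le_measure; rewrite ?inE//; apply: sub_qball.
    apply: (@le_trans _ _ (5 * k ^+ 3 * a)); last by rewrite ler_pM2r.
    have -> : 5 * k ^+ 3 * a = k * (2 * k * (k * a) + r) by rewrite /r; ring.
    rewrite ler_pM2l// lerD2r; apply: le_trans near _.
    by rewrite ler_pM2l ?mulr_gt0// -[leLHS]mul1r ler_pM2r.
  apply: le_trans (stable_qball_iter C1 dbl N x a0) _.
  by rewrite EFinM /m fineK.
have mrj j : (mu (qball K z (r / 2 ^+ j)) <= ((C' + 1) * (C ^+ N * m) * (2 ^- j * th ^+ j))%:E)%E.
  apply: (@le_trans _ _ (((C' + 1) * (2 ^- j * th ^+ j))%:E * mu (qball K z r))%E); last first.
    have -> : (C' + 1) * (C ^+ N * m) * (2 ^- j * th ^+ j) = (C' + 1) * (2 ^- j * th ^+ j) * (C ^+ N * m) by ring.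
    rewrite (EFinM _ (C ^+ N * m)); apply: lee_wpmul2l => //.
    by rewrite lee_fin !mulr_ge0 ?invr_ge0 ?exprn_ge0// addr_ge0// ltW.
  case: j => [|j].
    rewrite expr0 divr1 expr0 invr1 !mulr1; apply: lee_pemull => //.
    by rewrite lee_fin lerDr ltW.
  have rj0 : 0 < r / 2 ^+ j.+1 by rewrite divr_gt0.
  have rjr : r / 2 ^+ j.+1 < r by rewrite ltr_pdivrMr// ltr_pMr// exprn_egt1// ltr1n.
  apply: le_trans (hC' z _ _ rj0 rjr).2 _; apply: lee_wpmul2r => //.
  rewrite lee_fin; have -> : r / 2 ^+ j.+1 / r = (2^-1) ^+ j.+1.
    by rewrite exprVn; field; rewrite !gt_eqF.
  have -> : (2^-1 ^+ j.+1) `^ (1 + dl) = 2 ^- j.+1 * th ^+ j.+1.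
    rewrite powRD; last by rewrite (gt_eqF (addr_gt0 ltr01 dl0)).
    rewrite powRr1 ?exprn_ge0 ?invr_ge0// exprVn; congr (_ * _).
    by rewrite -exprVn -powR_mulrn ?invr_ge0// -powRrM mulrC powRrM powR_mulrn ?powR_ge0.
  apply: ler_wpM2r; last by rewrite lerDl.
  by rewrite mulr_ge0 ?invr_ge0 ?exprn_ge0.
have tg j : (\int[mu]_(y in qball K x a) g j y <=
   (2 / r * ((C' + 1) * (C ^+ N * m)) * th ^+ j)%:E)%E.
  rewrite ge0_integralZl//; last 2 first.
    by apply/measurable_EFinP; exact: measurable_indic.
    by rewrite lee_fin.
  rewrite integral_indic//.
  have -> : 2 / r * ((C' + 1) * (C ^+ N * m)) * th ^+ j =
     (2 ^+ j.+1 / r) * ((C' + 1) * (C ^+ N * m) * (2 ^- j * th ^+ j)).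
    by rewrite exprS; field; rewrite !gt_eqF.
  rewrite (EFinM (2 ^+ j.+1 / r)); apply: lee_wpmul2l; first by rewrite lee_fin.
  apply: le_trans (mrj j); apply: le_measure; rewrite ?inE//; exact: measurableI.
apply: le_trans; first by apply: lee_sum => j _; exact: tg.
rewrite sumEFin lee_fin -mulr_sumr.
apply: (@le_trans _ _ (2 / r * ((C' + 1) * (C ^+ N * m)) * (1 - th)^-1)).
  apply: ler_wpM2l; last exact: sum_geometric_le.
  rewrite !mulr_ge0 ?exprn_ge0 ?addr_ge0 ?invr_ge0// ?(ltW r0) ?(ltW C'0)//.
  by rewrite (le_trans _ C1).
have -> : 2 / r * ((C' + 1) * (C ^+ N * m)) * (1 - th)^-1 = 2 * D * m / r.
  by rewrite /D; field; rewrite gt_eqF//= gt_eqF// subr_gt0.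
have mx0 : 0 < Num.max a (rho K x z) by rewrite lt_max a0.
apply: (@le_trans _ _ (2 * D * m / Num.max a (rho K x z))).
  apply: ler_wpM2l; first by rewrite mulr_ge0// mulr_ge0// ltW.
  rewrite lef_pV2 ?posrE// ge_max; apply/andP; split.
    rewrite /r -[leLHS]mul1r ler_pM2r//.
    have : 1 <= k ^+ 2 by rewrite exprn_ege1.
    lra.
  apply: le_trans near _; rewrite /r ler_pM2r//.
  have : k <= k ^+ 2 by rewrite expr2 -[leLHS]mul1r ler_pM2r.
  by move: (k0); lra.
apply: ler_wpM2r; first by rewrite invr_ge0 ltW.
by apply: ler_wpM2r => //; rewrite lerDr mulr_ge0// ltW.
Qed.

End stable.

(** * A comparable kernel measurable for the product sigma-algebra *)

Section separable_kernel.
Context {R : realType} {X : pmetricType R}.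
Variable K : X -> X -> \bar R.
Hypothesis hK : quasi_metric_kernel K.
Variables (k : R).
Hypothesis k1 : 1 <= k.
Hypothesis tri : forall x y z, rho K x y <= k * (rho K x z + rho K z y).
Variable d : nat -> X.
Hypothesis dense_d : forall y e, 0 < e -> exists n, rho K y (d n) <= e.

Let k0 : 0 < k. Proof. exact: lt_le_trans ltr01 k1. Qed.

(** 1 / net_kernel is the infimum over n of max (rho(y, d_n), rho(z, d_n)), the
    distance of y and z through the net. *)
Definition net_kernel (z : borel X * borel X) : \bar R :=
  esups (fun n => mine (K z.1 (d n)) (K z.2 (d n))) 0%N.

Lemma measurable_net_kernel : measurable_fun setT net_kernel.
Proof.
apply: (measurable_fun_esups (f := fun n (z : borel X * borel X) => mine (K z.1 (d n)) (K z.2 (d n)))) => n.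
have mKn : measurable_fun setT (fun y : borel X => K y (d n)).
  under eq_fun do rewrite (qmk_sym hK).
  exact: measurable_kernel_section.
apply: measurable_mine.
  exact: measurableT_comp mKn measurable_fst.
exact: measurableT_comp mKn measurable_snd.
Qed.

Lemma net_kernel_ge z n : (mine (K z.1 (d n)) (K z.2 (d n)) <= net_kernel z)%E.
Proof. by apply: ereal_sup_ubound; exists n. Qed.

Lemma net_kernel_ge0 z : (0 <= net_kernel z)%E.
Proof.
by apply: le_trans (net_kernel_ge z 0%N); rewrite le_min !kernel_ge0.
Qed.

Lemma net_kernel_le y z : (net_kernel (y, z) <= (2 * k)%:E * K y z)%E.
Proof.
apply: ge_ereal_sup => _ [n _ <-] /=.
have [yz0|yz0] := eqVneq (rho K y z) 0.
  by rewrite (kernel_rho_eq0 hK yz0) gt0_muley ?leey// lte_fin mulr_gt0.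
have {}yz0 : 0 < rho K y z by rewrite lt_def yz0 rho_ge0.
rewrite (kernel_rho_gt0 hK yz0) -EFinM.
have k20 : 0 < rho K y z / (2 * k) by rewrite divr_gt0 ?mulr_gt0.
have [yn|yn] := leP (rho K y z / (2 * k)) (rho K y (d n)).
  rewrite ge_min; apply/orP; left; apply: le_trans (kernel_leV hK k20 yn) _.
  by rewrite invf_div.
rewrite ge_min; apply/orP; right.
have nz : rho K y z / (2 * k) <= rho K z (d n).
  have := tri y z (d n); rewrite (rho_sym hK (d n) z) => h.
  have {}yn : k * rho K y (d n) <= rho K y z / 2.
    have -> : rho K y z / 2 = k * (rho K y z / (2 * k)) by field; rewrite gt_eqF.
    by rewrite ler_pM2l// ltW.
  by rewrite ler_pdivrMr ?mulr_gt0//; lra.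
by apply: le_trans (kernel_leV hK k20 nz) _; rewrite invf_div.
Qed.

Lemma le_net_kernel y z : (K y z <= (2 * k)%:E * net_kernel (y, z))%E.
Proof.
have key e : 0 < e -> ((k * (rho K y z + e))^-1%:E <= net_kernel (y, z))%E.
  move=> e0; have [n yn] := dense_d y e0.
  have r0 := rho_ge0 hK y z.
  have ke : 0 < k * (rho K y z + e) by rewrite mulr_gt0 ?ltr_wpDl.
  apply: le_trans (net_kernel_ge _ n); rewrite le_min /=.
  apply/andP; split; apply: kernel_geV => //.
    apply: le_trans yn _; rewrite -[leLHS]mul1r; apply: ler_pM => //; first exact: ltW.
    by rewrite lerDr.
  by apply: le_trans (tri z (d n) y) _; rewrite (rho_sym hK z y) ler_pM2l// lerD2l.
have k20 : 0 < 2 * k by rewrite mulr_gt0.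
have [yz0|yz0] := eqVneq (rho K y z) 0.
  rewrite (kernel_rho_eq0 hK yz0).
  suff -> : net_kernel (y, z) = +oo%E by rewrite gt0_muley.
  have := net_kernel_ge0 (y, z); case E : (net_kernel (y, z)) => [s||]//.
  rewrite lee_fin => s0.
  have e0 : 0 < (k * (s + 1))^-1 by rewrite invr_gt0 mulr_gt0// ltr_wpDl.
  have := key _ e0; rewrite yz0 add0r E lee_fin invfM invrK mulrA mulVf ?gt_eqF// mul1r.
  by rewrite gerDl leNgt ltr01.
have {}yz0 : 0 < rho K y z by rewrite lt_def yz0 rho_ge0.
rewrite (kernel_rho_gt0 hK yz0); have := key _ yz0 => /(lee_wpmul2l _).
move=> /(_ (2 * k)%:E); rewrite lee_fin => /(_ (ltW k20)); apply: le_trans.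
by rewrite -EFinM lee_fin le_eqVlt; apply/orP; left; apply/eqP; field; rewrite !gt_eqF ?addr_gt0.
Qed.

Variables (p q : R).
Hypothesis q1 : 1 < q.
Hypothesis pq : p^-1 + q^-1 = 1.
Variable sigma : {sigma_finite_measure set (borel X) -> \bar R}.
Variable mu : {measure set (borel X) -> \bar R}.
Hypothesis hst : stable K mu.
Hypothesis mu0 : mu setT != 0%E.

Definition net_pot (g : X -> R) (y : X) : \bar R :=
  (\int[sigma]_z (net_kernel (y, z) * (g z)%:E))%E.

Lemma pot_fun_le_net_pot (g : X -> R) y : measurable_fun [set: borel X] g -> (forall z, 0 <= g z) ->
  (pot_fun K sigma g y <= (2 * k)%:E * net_pot g y)%E.
Proof.
move=> mg g0; rewrite /net_pot -ge0_integralZl//; last 3 first.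
- apply: emeasurable_funM; last exact/measurable_EFinP.
  exact: measurableT_comp measurable_net_kernel (measurable_pair1 _).
- by move=> z _; rewrite mule_ge0 ?net_kernel_ge0 ?lee_fin.
- by rewrite lee_fin mulr_ge0// ltW.
apply: le_integral_ge0 => z _; first by rewrite mule_ge0 ?kernel_ge0 ?lee_fin.
by rewrite muleA; apply: lee_wpmul2r; rewrite ?lee_fin// le_net_kernel.
Qed.

Lemma net_pot_ge0 (g : X -> R) y : (forall z, 0 <= g z) -> (0 <= net_pot g y)%E.
Proof.
by move=> g0; apply: integral_ge0 => z _; rewrite mule_ge0 ?net_kernel_ge0 ?lee_fin.
Qed.

Lemma measurable_net_pot (g : X -> R) : measurable_fun [set: borel X] g -> (forall z, 0 <= g z) ->
  measurable_fun [set: borel X] (net_pot g).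
Proof.
move=> mg g0.
apply: (measurable_fun_fubini_tonelli_F (fun yz : borel X * borel X =>
  (net_kernel yz * (g yz.2)%:E)%E)).
  apply: emeasurable_funM; first exact: measurable_net_kernel.
  by apply/measurable_EFinP; exact: measurableT_comp mg measurable_snd.
by move=> yz; rewrite mule_ge0 ?net_kernel_ge0 ?lee_fin.
Qed.

(** The two-weight estimate applied to the restriction of mu to B_a(x).  Its potential
    is at most of order b / max(a, rho(x,.)), whose q-th power is summed over dyadic
    shells and compared with the integral of sigma(B_t(x)) / t^(1+q). *)
Lemma stable_test_set : exists2 C : R, 0 < C & forall (x : X) (a J : R),
  0 < a -> 0 < J ->
  (\int[lebesgue_measure]_(t in `]a, +oo[)
     (sigma (qball K x t) / (t `^ (1 + q))%:E) <= J%:E)%E ->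
  let b := fine (mu (qball K x a)) in
  exists G : set (borel X), [/\ measurable G, G `<=` qball K x a,
    ((b / 2)%:E <= mu G)%E &
    forall g : X -> R, measurable_fun [set: borel X] g -> (forall z, 0 <= g z) ->
    (\int[mu]_(y in G) (net_pot g y `^ p) <=
     ((C * (b `^ (q - 1) * J)) `^ (p - 1))%:E * \int[sigma]_z (g z `^ p)%:E)%E].
Proof.
have [M M0 hM] := stable_potential hK k1 tri hst.
have kM0 : 0 < 2 * k * M by rewrite !mulr_gt0.
exists (2 * (2 * k * M) `^ q * (2 * 4 `^ q)).
  by rewrite !mulr_gt0 ?powR_gt0.
move=> x a J a0 J0 hJ b.
have mB : measurable (qball K x a : set (borel X)) by exact: measurable_qball.
have Boo : (mu (qball K x a) < +oo)%E by exact: (stable_qball_lty hK k1 tri hst).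
have mf : mu (qball K x a) \is a fin_num by rewrite ge0_fin_numE.
have b0 : 0 < b.
  by rewrite fine_gt0// Boo andbT; exact: (stable_qball_gt0 hK hst mu0).
have muB : mu (qball K x a) = b%:E by rewrite fineK.
pose m := mfrestr mB Boo.
have msec z : measurable_fun [set: borel X] (fun y : borel X => net_kernel (y, z)).
  exact: measurableT_comp measurable_net_kernel (measurable_pair2 _).
pose mx z := Num.max a (rho K x z).
have mx0 z : 0 < mx z by rewrite lt_max a0.
have Ple z : (\int[m]_y net_kernel (y, z) <= (2 * k * M * b / mx z)%:E)%E.
  rewrite ge0_integral_mrestr//; last by move=> y; exact: net_kernel_ge0.
  have -> : 2 * k * M * b / mx z = 2 * k * (M * b / mx z) by ring.
  rewrite EFinM; apply: (@le_trans _ _ ((2 * k)%:E * \int[mu]_(y in qball K x a) K z y)%E).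
    rewrite -ge0_integralZl//; last 3 first.
    - by apply: measurable_funTS; exact: measurable_kernel_section.
    - by move=> y _; exact: kernel_ge0.
    - by rewrite lee_fin mulr_ge0// ltW.
    apply: le_integral_ge0 => y _; first exact: net_kernel_ge0.
    by rewrite (qmk_sym hK z y); exact: net_kernel_le.
  by apply: lee_wpmul2l; [rewrite lee_fin mulr_ge0// ltW|exact: hM].
have Pge z : (((2 * k * (k * (rho K x z + a)))^-1 * b)%:E <= \int[m]_y net_kernel (y, z))%E.
  rewrite ge0_integral_mrestr//; last by move=> y; exact: net_kernel_ge0.
  rewrite EFinM -muB -integral_cst//.
  have s0 : 0 < k * (rho K x z + a) by rewrite mulr_gt0// ltr_wpDl// rho_ge0.
  apply: le_integral_ge0 => y; first by rewrite lee_fin invr_ge0 mulr_ge0 ?(ltW s0)// mulr_ge0// ltW.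
  rewrite in_qball// => xy.
  have : ((k * (rho K x z + a))^-1%:E <= K y z)%E.
    apply: kernel_geV => //; apply: le_trans (tri y z x) _.
    by rewrite (rho_sym hK y x) ler_pM2l// addrC lerD2l.
  move=> /le_trans/(_ (le_net_kernel y z)).
  by rewrite -lee_pdivrMl ?mulr_gt0//= -EFinM -invfM.
pose P z := fine (\int[m]_y net_kernel (y, z)).
have Pf z : (\int[m]_y net_kernel (y, z))%E \is a fin_num.
  rewrite ge0_fin_numE; first exact: le_lt_trans (Ple z) (ltry _).
  by apply: integral_ge0 => y _; exact: net_kernel_ge0.
have P0 z : 0 < P z.
  apply: lt_le_trans (_ : (2 * k * (k * (rho K x z + a)))^-1 * b <= _).
    by rewrite mulr_gt0// invr_gt0 !mulr_gt0// ltr_wpDl// rho_ge0.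
  by rewrite -lee_fin fineK.
have mP : measurable_fun [set: borel X] P.
  apply: (measurableT_comp (fine_measurable _)) => //.
  exact: (measurable_fun_fubini_tonelli_G net_kernel measurable_net_kernel net_kernel_ge0).
pose Q := (2 * k * M * b) `^ q * (2 * 4 `^ q) * J.
have Q0 : 0 < Q by rewrite /Q !mulr_gt0 ?powR_gt0// !mulr_gt0.
have PQ : (\int[sigma]_z (P z `^ q)%:E <= Q%:E)%E.
  pose c j : R := (2 ^+ j * a) `^ (- q).
  pose B j := qball K x (2 ^+ j.+1 * a).
  have mBj j : measurable (B j : set (borel X)) by exact: measurable_qball.
  apply: (@le_trans _ _ (\int[sigma]_z (((2 * k * M * b) `^ q)%:E *
      \sum_(j <oo) ((c j)%:E * (\1_(B j) z)%:E)))%E).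
    apply: le_integral_ge0 => z _; first by rewrite lee_fin powR_ge0.
    have [j /andP[j1 j2]] : exists j : nat, 2 ^+ j <= mx z / a < 2 ^+ j.+1.
      by apply: dyadic_bracket; rewrite ler_pdivlMr// mul1r le_max lexx.
    have {}j1 : 2 ^+ j * a <= mx z by rewrite -ler_pdivlMr.
    have {}j2 : mx z < 2 ^+ j.+1 * a by rewrite -ltr_pdivrMr.
    have aj : 0 < 2 ^+ j * a by rewrite mulr_gt0// exprn_gt0.
    apply: (@le_trans _ _ (((2 * k * M * b) `^ q)%:E * ((c j)%:E * (\1_(B j) z)%:E))%E); last first.
      apply: lee_wpmul2l; first by rewrite lee_fin powR_ge0.
      apply: (nneseries_ge_term j (f := fun j => (c j)%:E * (\1_(B j) z)%:E)%E).
      by move=> i; rewrite mule_ge0// lee_fin powR_ge0.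
    rewrite indicE mem_set; last first.
      rewrite /B in_qball//; apply: le_trans (ltW j2); by rewrite le_max lexx orbT.
    rewrite mule1 -EFinM lee_fin /c powRN -[((2 ^+ j * a) `^ q)^-1]powR_inv1 ?powR_ge0//.
    rewrite powRAC (powR_inv1 (ltW aj)) -powRM ?invr_ge0 ?(ltW aj)//; last first.
      by rewrite mulr_ge0 ?(ltW kM0) ?(ltW b0).
    apply: ge0_ler_powR; first by rewrite (le_trans ler01)// ltW.
    - by rewrite nnegrE ltW.
    - by rewrite nnegrE mulr_ge0 ?invr_ge0 ?(ltW aj)// mulr_ge0 ?(ltW kM0) ?(ltW b0).
    rewrite -lee_fin fineK//; apply: le_trans (Ple z) _; rewrite lee_fin.
    apply: ler_wpM2l; first by rewrite mulr_ge0 ?(ltW kM0) ?(ltW b0).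
    by rewrite lef_pV2 ?posrE ?mx0.
  have mcB j : measurable_fun [set: borel X] (fun z => (c j)%:E * (\1_(B j) z)%:E)%E.
    by apply: measurable_funeM; apply/measurable_EFinP; exact: measurable_indic.
  have cB0 j z : (0 <= (c j)%:E * (\1_(B j) z)%:E)%E by rewrite mule_ge0// lee_fin powR_ge0.
  rewrite ge0_integralZl//; last 3 first.
  - exact: ge0_emeasurable_sum.
  - by move=> z _; exact: nneseries_ge0.
  - by rewrite lee_fin powR_ge0.
  rewrite integral_nneseries//.
  have QE : Q = (2 * k * M * b) `^ q * (2 * 4 `^ q * J) by rewrite /Q; ring.
  rewrite QE (EFinM ((2 * k * M * b) `^ q)); apply: lee_wpmul2l; first by rewrite lee_fin powR_ge0.
  apply: (@le_trans _ _ ((2 * 4 `^ q)%:E * \int[lebesgue_measure]_(t in `]a, +oo[)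
     (sigma (qball K x t) / (t `^ (1 + q))%:E))%E); last first.
    by rewrite (EFinM (2 * 4 `^ q)); apply: lee_wpmul2l => //; rewrite lee_fin mulr_ge0 ?powR_ge0.
  apply: le_trans (sum_large_radii _ _ a0 _); last 3 first.
  - by move=> t; exact: measure_ge0.
  - move=> s t st; apply: le_measure; rewrite ?inE; [exact: measurable_qball..|].
    by move=> z; rewrite !in_qball// => /le_trans; exact.
  - by rewrite (le_trans ler01)// ltW.
  apply: lee_nneseries => j _; first by move=> _; apply: integral_ge0 => z _; exact: cB0.
  rewrite ge0_integralZl//; last 2 first.
  - by apply/measurable_EFinP; exact: measurable_indic.
  - by rewrite lee_fin powR_ge0.
  by rewrite integral_indic// setIT muleC.
have mT : m setT = b%:E by rewrite /m /= /mfrestr /mrestr setTI.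
have [G [mG Gb hG]] := @two_weight_large_set R p q q1 pq _ _ _ _ m sigma net_kernel P Q b
  measurable_net_kernel net_kernel_ge0 mP P0 (fun z => esym (fineK (Pf z))) b0 mT Q0 PQ.
exists (G `&` qball K x a); split.
- exact: measurableI.
- exact: subIsetr.
- by apply: le_trans Gb _; rewrite /m /= /mfrestr /mrestr.
- move=> g mg g0.
  have mgp : measurable_fun [set: borel X] (fun y => net_pot g y `^ p)%E.
    exact: (measurableT_comp (measurable_poweR p) (measurable_net_pot mg g0)).
  have := hG g mg g0.
  rewrite integral_mkcond ge0_integral_mrestr//; last 2 first.
  - by apply: (measurable_restrictT (fun y : borel X => (net_pot g y `^ p)%E) mG).1; exact: measurable_funTS.
  - by move=> y; apply: erestrict_ge0 => ? _; exact: poweR_ge0.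
  rewrite -integral_mkcondr setIC.
  suff -> : 2 * Q / b = 2 * (2 * k * M) `^ q * (2 * 4 `^ q) * (b `^ (q - 1) * J) by [].
  rewrite /Q powRM ?(ltW kM0) ?(ltW b0)//.
  have -> : b `^ q = b `^ (q - 1) * b.
    rewrite -[X in _ = _ * X](powRr1 (ltW b0)) -powRD ?subrK// (gt_eqF b0) implybT//.
  by field; rewrite gt_eqF.
Qed.

End separable_kernel.

(** * Balls violating the growth condition *)

Section violation.
Context {R : realType} {X : pmetricType R}.
Variable K : X -> X -> \bar R.
Hypothesis hK : quasi_metric_kernel K.
Variable q : R.
Hypothesis q1 : 1 < q.
Variable sigma : {sigma_finite_measure set (borel X) -> \bar R}.
Local Open Scope ereal_scope.

Definition small_scale x a := \int[lebesgue_measure]_(t in `]0%R, a[)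
  (sigma (qball K x t) / (t ^+ 2)%:E).

Definition large_scale x a := \int[lebesgue_measure]_(t in `]a, +oo[)
  (sigma (qball K x t) / (t `^ (1 + q))%:E).

Lemma large_scale_ge0 x a : (0 < a)%R -> 0 <= large_scale x a.
Proof.
move=> a0; apply: integral_ge0 => t /=; rewrite in_itv/= andbT => at0.
have t0 : (0 < t)%R by exact: lt_trans at0.
by rewrite mule_ge0// inver gt_eqF ?powR_gt0// lee_fin invr_ge0 powR_ge0.
Qed.

(** The factors 2^((n+1)(q-1)) offset the weights 2^(-n-1) of the superposition, and
    n + 1 still tends to infinity.  J is a positive real upper bound of the right-hand
    integral, which may itself be zero. *)
Lemma violating_sequence : ~ ball_growth_condition K sigma q ->
  exists (x : nat -> X) (a J : nat -> R), forall n,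
  [/\ (0 < a n)%R, (0 < J n)%R, large_scale (x n) (a n) <= (J n)%:E &
    (n.+1%:R * (2 ^+ n.+1) `^ (q - 1) * (a n `^ (q - 1) * J n))%:E < small_scale (x n) (a n)].
Proof.
move=> hn.
suff H n : exists t : X * (R * R), [/\ (0 < t.2.1)%R, (0 < t.2.2)%R, large_scale t.1 t.2.1 <= (t.2.2)%:E &
    (n.+1%:R * (2 ^+ n.+1) `^ (q - 1) * (t.2.1 `^ (q - 1) * t.2.2))%:E < small_scale t.1 t.2.1].
  have [f hf] := choice H.
  by exists (fun n => (f n).1), (fun n => (f n).2.1), (fun n => (f n).2.2).
set C := (n.+1%:R * (2 ^+ n.+1) `^ (q - 1))%R.
have C0 : (0 < C)%R by rewrite mulr_gt0// powR_gt0// exprn_gt0.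
have [x [a [a0 hxa]]] : exists (x : X) (a : R), (0 < a)%R /\
    ~ (small_scale x a <= (C * a `^ (q - 1))%:E * large_scale x a).
  apply: contrapT => hne; apply: hn; exists C => x a a0.
  by apply: contrapT => hxa; apply: hne; exists x, a.
have c0 : (0 < C * a `^ (q - 1))%R by rewrite mulr_gt0// powR_gt0.
move/negP: hxa; rewrite -ltNge => hxa.
have t0 := large_scale_ge0 x a0.
have : large_scale x a \is a fin_num.
  rewrite ge0_fin_numE// ltey; apply/eqP => ty.
  by move: hxa; rewrite ty gt0_muley ?lte_fin// ltNge leey.
move: t0 hxa; rewrite -/(large_scale x a); case Et : (large_scale x a) => [j||]// ; rewrite lee_fin => j0 hxa _.
have [J [jJ hJ]] : exists J : R, (j < J)%R /\ (C * (a `^ (q - 1) * J))%:E < small_scale x a.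
  move: hxa; case: (small_scale x a) => [l||]//.
    rewrite -EFinM lte_fin => cjl; exists ((j + l / (C * a `^ (q - 1))) / 2)%R.
    have : (j < l / (C * a `^ (q - 1)))%R by rewrite ltr_pdivlMr// mulrC.
    split; first by lra.
    rewrite mulrA lte_fin mulrC -ltr_pdivlMr//; lra.
  by move=> _; exists (j + 1)%R; split; [rewrite ltrDl|rewrite ltry].
by exists (x, (a, J)); split => //=; [exact: le_lt_trans jJ|rewrite Et lee_fin ltW].
Qed.

Lemma small_scale_gt0_sigma x a : 0 < small_scale x a -> sigma setT != 0.
Proof.
move=> h; apply/eqP => s0; move: h; rewrite /small_scale integral0_eq ?ltxx// => t _.
suff -> : sigma (qball K x t) = 0 by rewrite mul0e.
apply/eqP; rewrite -measure_le0 -s0; apply: le_measure; rewrite ?inE//.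
exact: measurable_qball.
Qed.

(** Finiteness of the integral over large radii at one point makes every ball around
    that point of finite measure. *)
Lemma large_scale_lty_sigma x a t : (0 < a)%R -> large_scale x a < +oo -> sigma (qball K x t) < +oo.
Proof.
move=> a0 tf.
have mono s r : (s <= r)%R -> sigma (qball K x s) <= sigma (qball K x r).
  move=> sr; apply: le_measure; rewrite ?inE; [exact: measurable_qball..|].
  by move=> z; rewrite !in_qball// => /le_trans; exact.
have [j tj] : exists j : nat, (t <= 2 ^+ j.+1 * a)%R.
  exists (Num.truncn (t / a)); rewrite -ler_pdivrMr//.
  apply: le_trans (ltW (truncnS_gt _)) _.
  by rewrite -natrX ler_nat ltnW// ltn_expl.
apply: le_lt_trans (mono _ _ tj) _.
have q0 : (0 <= q)%R by rewrite (le_trans ler01)// ltW.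
have := @sum_large_radii R (fun t => sigma (qball K x t)) (fun t => measure_ge0 _ _) mono a q a0 q0.
set T := (X in _ <= X) => hT.
have T1 : T < +oo.
  by rewrite lte_mul_pinfty// lee_fin mulr_ge0// powR_ge0.
have := le_lt_trans hT T1.
have aj : (0 < (2 ^+ j * a) `^ (- q))%R by rewrite powR_gt0// mulr_gt0// exprn_gt0.
move/(le_lt_trans (nneseries_ge_term j (f := fun j => sigma (qball K x (2 ^+ j.+1 * a)%R) * ((2 ^+ j * a) `^ (- q))%:E) _)).
move=> /(_ (fun j => mule_ge0 (measure_ge0 _ _) _)).
have pw i : 0 <= ((2 ^+ i * a) `^ (- q))%:E by rewrite lee_fin powR_ge0.
move=> /(_ pw) h; rewrite ltey; apply/eqP => sy.
by move: h; rewrite sy gt0_mulye// lte_fin.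
Qed.

End violation.

(** * Superposition of the test measures *)

Section test_measure.
Context {R : realType} {X : pmetricType R}.
Variable K : X -> X -> \bar R.
Hypothesis hK : quasi_metric_kernel K.
Variables (k : R).
Hypothesis k1 : 1 <= k.
Hypothesis tri : forall x y z, rho K x y <= k * (rho K x z + rho K z y).
Variable d : nat -> X.
Hypothesis dense_d : forall y e, 0 < e -> exists n, rho K y (d n) <= e.
Variables (p q : R).
Hypothesis q1 : 1 < q.
Hypothesis pq : p^-1 + q^-1 = 1.
Variable sigma : {sigma_finite_measure set (borel X) -> \bar R}.
Variable mu : {measure set (borel X) -> \bar R}.
Variables (x : nat -> X) (a J b : nat -> R) (G : nat -> set (borel X)) (C : R).
Local Open Scope ereal_scope.
Hypothesis seqP : forall n,
  [/\ (0 < a n)%R, (0 < J n)%R, large_scale K q sigma (x n) (a n) <= (J n)%:E &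
    (n.+1%:R * (2 ^+ n.+1) `^ (q - 1) * (a n `^ (q - 1) * J n))%:E < small_scale K sigma (x n) (a n)].
Hypothesis C0 : (0 < C)%R.
Hypothesis b0 : forall n, (0 < b n)%R.
Hypothesis mG : forall n, measurable (G n).
Hypothesis Goo : forall n, mu (G n) < +oo.
Let H n := (C * (b n `^ (q - 1) * J n))%R.
Hypothesis Gtest : forall n (g : X -> R), measurable_fun [set: borel X] g ->
  (forall z, 0 <= g z)%R ->
  \int[mu]_(y in G n) (net_pot K d sigma g y `^ p) <=
     (H n `^ (p - 1))%:E * \int[sigma]_z (g z `^ p)%:E.

Let k0 : (0 < k)%R. Proof. exact: lt_le_trans ltr01 k1. Qed.

Let H0 n : (0 < H n)%R.
Proof. by have [_ J0 _ _] := seqP n; rewrite !mulr_gt0// powR_gt0. Qed.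

(** H_n^(1-p) normalises the trace inequality on G_n to constant 1. *)
Definition test_weight n : R := ((2 ^+ n.+1)^-1 / (H n `^ (p - 1)))%R.
Local Notation w := test_weight.

Lemma test_weight_gt0 n : (0 < w n)%R.
Proof. by rewrite divr_gt0 ?powR_gt0// invr_gt0 exprn_gt0. Qed.

Local Notation test_measure := (weighted_series test_weight_gt0 mG Goo).

Lemma test_measure_test (g : X -> R) : measurable_fun [set: borel X] g ->
  (forall z, 0 <= g z)%R ->
  \int[test_measure]_y (net_pot K d sigma g y `^ p) <= \int[sigma]_z (g z `^ p)%:E.
Proof.
move=> mg g0.
rewrite integral_weighted_series; last 2 first.
- exact: (measurableT_comp (measurable_poweR p) (measurable_net_pot hK d sigma mg g0)).
- by move=> y; exact: poweR_ge0.
set I := \int[sigma]_z _.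
have I0 : 0 <= I by apply: integral_ge0 => z _; rewrite lee_fin powR_ge0.
apply: lime_le.
  apply: is_cvg_nneseries => n _ _; rewrite mule_ge0 ?lee_fin ?(ltW (test_weight_gt0 n))//.
  by apply: integral_ge0 => y _; exact: poweR_ge0.
apply: nearW => n.
apply: (@le_trans _ _ (\sum_(0 <= i < n) ((2 ^+ i.+1)^-1%:E * I))).
  apply: lee_sum => i _.
  apply: (@le_trans _ _ ((w i)%:E * ((H i `^ (p - 1))%:E * I))).
    by apply: lee_wpmul2l; [rewrite lee_fin ltW// test_weight_gt0|exact: Gtest].
  rewrite muleA -EFinM /w mulfVK// gt_eqF// powR_gt0//.
rewrite -ge0_sume_distrl; last by move=> i _; rewrite lee_fin invr_ge0 exprn_ge0.
by rewrite sumEFin -[leRHS]mul1e; apply: lee_wpmul2r => //; rewrite lee_fin sum_half_pow.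
Qed.

Lemma sigma_qball_lty t : sigma (qball K (x 0%N) t) < +oo.
Proof.
have [a0 _ tJ _] := seqP 0%N.
exact: (large_scale_lty_sigma hK q1 t a0 (le_lt_trans tJ (ltry _))).
Qed.

Lemma sigma_setT_neq0 : sigma setT != 0.
Proof.
have [a0 J0 _ hd] := seqP 0%N.
apply: (small_scale_gt0_sigma hK (x := x 0%N) (a := a 0%N)); apply: lt_trans hd.
by rewrite lte_fin !mulr_gt0 ?powR_gt0// exprn_gt0.
Qed.

(** Apply the trace inequality to the indicator of a ball of positive and finite
    sigma-measure: its potential is bounded below on the ball. *)
Lemma test_measure_qball_lty t : test_measure (qball K (x 0%N) t) < +oo.
Proof.
have mB r : measurable (qball K (x 0%N) r : set (borel X)) by exact: measurable_qball.
have sB r s : (r <= s)%R -> qball K (x 0%N) r `<=` qball K (x 0%N) s.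
  by move=> rs z; rewrite !in_qball// => /le_trans; exact.
have [n n0] : exists n : nat, 0 < sigma (qball K (x 0%N) n%:R).
  apply: contrapT => /forallNP hn; move/eqP: sigma_setT_neq0; apply.
  apply/eqP; rewrite -measure_le0.
  apply: (@le_trans _ _ (\sum_(n <oo) sigma (qball K (x 0%N) n%:R))); last first.
    by rewrite eseries0// => i _ _; apply/eqP; rewrite -measure_le0 leNgt; apply/negP; exact: hn.
  by apply: measure_sigma_subadditive => //; rewrite qball_cover.
pose s := Num.max t n.+1%:R; have s0 : (0 < s)%R by rewrite lt_max ltr0n orbT.
apply: (@le_lt_trans _ _ (test_measure (qball K (x 0%N) s))).
  by apply: le_measure; rewrite ?inE//; apply: sB; rewrite le_max lexx.
pose B := qball K (x 0%N) s.
have Sf : sigma B \is a fin_num by rewrite ge0_fin_numE// sigma_qball_lty.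
pose S := fine (sigma B).
have S0 : (0 < S)%R.
  rewrite fine_gt0// sigma_qball_lty andbT; apply: lt_le_trans n0 _.
  apply: le_measure; rewrite ?inE; [exact: mB|exact: mB|apply: sB].
  by rewrite /s le_max ler_nat leqnSn orbT.
pose g : X -> R := \1_B.
have mg : measurable_fun [set: borel X] g by apply: measurable_indic; exact: mB.
have g0 z : (0 <= g z)%R by [].
pose c : R := ((2 * k * (k * (s + s)))^-1)%R.
have c0 : (0 < c)%R by rewrite invr_gt0 !mulr_gt0 ?addr_gt0.
have ks : (0 < k * (s + s))%R by rewrite mulr_gt0 ?addr_gt0.
have pot y : B y -> (c * S)%:E <= net_pot K d sigma g y.
  rewrite /B in_qball// => xy.
  rewrite EFinM /S fineK// -integral_cst; last exact: mB.
  rewrite /net_pot integral_mkcond; apply: le_integral_ge0 => z _.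
    by apply: erestrict_ge0 => ? _; rewrite lee_fin ltW.
  rewrite patchE /g indicE; case: (boolP (z \in B)) => [|_]; last by rewrite mule0.
  rewrite inE /B in_qball// => xz; rewrite mule1 /=.
  have : (k * (s + s))^-1%:E <= K y z.
    apply: kernel_geV => //; apply: le_trans (tri y z (x 0%N)) _.
    by rewrite (rho_sym hK y) ler_pM2l// lerD.
  move=> /le_trans/(_ (le_net_kernel hK k1 tri dense_d y z)).
  by rewrite -lee_pdivrMl ?mulr_gt0//= -EFinM -invfM.
have p0 : (p != 0)%R by rewrite gt_eqF// (lt_trans ltr01)// (conjugate_gt1 q1 pq).
have : ((c * S) `^ p)%:E * test_measure B <= S%:E.
  rewrite -integral_cst; last exact: mB.
  apply: (@le_trans _ _ (\int[test_measure]_y (net_pot K d sigma g y `^ p))).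
    rewrite integral_mkcond; apply: le_integral_ge0 => v _.
      by apply: erestrict_ge0 => ? _; rewrite lee_fin powR_ge0.
    rewrite patchE; case: (boolP (v \in B)) => [|_]; last exact: poweR_ge0.
    rewrite inE => /pot h; rewrite /= -poweR_EFin; apply: gt0_ler_poweR => //.
    - by rewrite ltW// (lt_trans ltr01)// (conjugate_gt1 q1 pq).
    - by rewrite in_itv/= leey andbT lee_fin mulr_ge0// ltW.
    - by rewrite in_itv/= leey andbT net_pot_ge0.
  apply: le_trans (test_measure_test mg g0) _.
  rewrite /S fineK// -[X in sigma X]setIT -integral_indic; [|exact: measurableT|exact: mB].
  apply: le_integral_ge0 => z _; first by rewrite lee_fin powR_ge0.
  by rewrite lee_fin /g indicE; case: (_ \in _); rewrite ?powR1// powR0.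
move=> h; rewrite ltey; apply/eqP => By; move: h.
by rewrite By gt0_muley ?lte_fin ?powR_gt0 ?mulr_gt0// leye_eq.
Qed.

Lemma test_measure_sigma_finite : sigma_finite setT test_measure.
Proof.
exists (fun n => qball K (x 0%N) n%:R); first by rewrite qball_cover.
by move=> n; split; [exact: measurable_qball|exact: test_measure_qball_lty].
Qed.

(** Since (p-1)(q-1) = 1, the power 1 - q of the normalisation H_n^(1-p) gives back
    H_n = C b_n^(q-1) J_n; the mass b_n cancels and n + 1 < D (e/2)^(1-q) C would hold
    for every n. *)
Lemma no_uniform_small_scale_bound (D e : R) : (0 < D)%R -> (0 < e)%R ->
  (forall n, small_scale K sigma (x n) (a n) <=
    (D * (e * w n * (b n / 2) / a n) `^ (1 - q))%:E) -> False.
Proof.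
move=> D0 e0 hD.
pose E := (D * (e / 2) `^ (1 - q) * C)%R.
suff key n : (n.+1%:R < E)%R.
  have := key (Num.truncn E); rewrite ltNge => /negP; apply; exact: ltW (truncnS_gt _).
have [a0 J0 _ hn] := seqP n.
have := lt_le_trans hn (hD n); rewrite lte_fin.
have T0 : (0 < 2 ^+ n.+1 :> R)%R by rewrite exprn_gt0.
set T := (2 ^+ n.+1)%R in T0 *.
have invP (y : R) : (0 < y)%R -> (y^-1 `^ (1 - q) = y `^ (q - 1))%R.
  by move=> y0; rewrite -(powR_inv1 (ltW y0)) -powRrM mulN1r opprB.
have Hp : (0 < H n `^ (p - 1))%R by exact: powR_gt0.
have -> : (e * w n * (b n / 2) / a n = e / 2 * (T^-1 * ((H n `^ (p - 1))^-1 * (b n * (a n)^-1))))%R.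
  by rewrite /w -/T; ring.
rewrite powRM ?mulr_ge0 ?invr_ge0 ?(ltW e0) ?(ltW T0) ?(ltW Hp) ?(ltW (b0 n)) ?(ltW a0)//.
rewrite (@powRM _ T^-1) ?mulr_ge0 ?invr_ge0 ?(ltW T0) ?(ltW Hp) ?(ltW (b0 n)) ?(ltW a0)//.
rewrite (@powRM _ (_ `^ _)^-1) ?mulr_ge0 ?invr_ge0 ?(ltW Hp) ?(ltW (b0 n)) ?(ltW a0)//.
rewrite (@powRM _ (b n)) ?invr_ge0 ?(ltW (b0 n)) ?(ltW a0)//.
rewrite !invP// -powRrM (conjugate_subM q1 pq) powRr1 ?(ltW (H0 n))//.
have bq : (0 < b n `^ (q - 1))%R by rewrite powR_gt0.
have -> : (b n `^ (1 - q) = (b n `^ (q - 1))^-1)%R by rewrite -opprB powRN.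
have Tq : (0 < T `^ (q - 1))%R by rewrite powR_gt0.
have aq : (0 < a n `^ (q - 1))%R by rewrite powR_gt0.
have -> : (D * ((e / 2) `^ (1 - q) * (T `^ (q - 1) * (H n * ((b n `^ (q - 1))^-1 * a n `^ (q - 1))))) =
   E * (T `^ (q - 1) * (a n `^ (q - 1) * J n)))%R.
  by rewrite /E /H; field; rewrite gt_eqF.
by rewrite -mulrA ltr_pM2r// !mulr_gt0.
Qed.

End test_measure.

(** * From supersolutions to the growth condition *)

Section criterion.
Context {R : realType} {X : pmetricType R}.
Variable K : X -> X -> \bar R.
Hypothesis hK : quasi_metric_kernel K.
Variables (p q : R).
Hypothesis q1 : 1 < q.
Hypothesis pq : p^-1 + q^-1 = 1.
Variable sigma : {sigma_finite_measure set (borel X) -> \bar R}.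
Variable mu : {measure set (borel X) -> \bar R}.
Hypothesis hst : stable K mu.
Hypothesis mu0 : mu setT != 0%E.
Local Open Scope ereal_scope.

Definition supersolution (omega : {measure set (borel X) -> \bar R}) (u : X -> R) (e : R) :=
  [/\ measurable_fun [set: borel X] u, (forall y, 0 <= u y)%R, (0 <= e)%R &
    {ae sigma, forall y, pot_fun K sigma (fun z => (u z `^ q)%R) y +
      e%:E * pot_measure K omega y <= (u y)%:E}].

(** The trace inequality for omega, through a measurable majorant F because the
    potential of g need not be measurable. *)
Definition trace_bound (omega : {measure set (borel X) -> \bar R}) :=
  exists2 C : R, (0 <= C)%R & forall g : X -> R,
  measurable_fun [set: borel X] g -> (forall z, 0 <= g z)%R ->
  exists F : X -> \bar R, [/\ measurable_fun [set: borel X] F,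
    (forall y, pot_fun K sigma g y `^ p <= F y) &
    \int[omega]_y F y <= C%:E * \int[sigma]_z (g z `^ p)%:E].

(** It suffices to exhibit, for each sigma-finite superposition of restrictions of mu
    satisfying the trace inequality, a supersolution whose truncated potentials see all
    the terms of the superposition with a common factor e'. *)
Lemma ball_growth_criterion :
  (forall (w : nat -> R) (G : nat -> set (borel X)) (w0 : forall n, (0 < w n)%R)
      (mG : forall n, measurable (G n)) (Goo : forall n, mu (G n) < +oo),
    let tau := weighted_series w0 mG Goo in
    sigma_finite setT tau -> trace_bound tau ->
    exists omega u e, supersolution omega u e /\
      exists2 e' : R, (0 < e')%R & forall n x a, (0 < a)%R -> G n `<=` qball K x a ->
        (e' * w n / a)%:E * mu (G n) <= trunc_pot K q sigma omega u e x a) ->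
  ball_growth_condition K sigma q.
Proof.
move=> hyp; apply: contrapT => /violating_sequence[x [a [J seqP]]].
have [k k1 tri] := rho_quasi hK.
have k0 : (0 < k)%R by exact: lt_le_trans ltr01 k1.
have [d dense_d] := stable_dense hK k1 tri hst mu0.
have [C C0 hC] := stable_test_set hK k1 tri dense_d q1 pq sigma hst mu0.
have /choice[G hG] : forall n, exists G : set (borel X), [/\ measurable G,
    G `<=` qball K (x n) (a n),
    ((fine (mu (qball K (x n) (a n))) / 2)%:E <= mu G)%E &
    forall g : X -> R, measurable_fun [set: borel X] g -> (forall z, 0 <= g z)%R ->
    (\int[mu]_(y in G) (net_pot K d sigma g y `^ p) <=
     ((C * (fine (mu (qball K (x n) (a n))) `^ (q - 1) * J n)) `^ (p - 1))%:E *
       \int[sigma]_z (g z `^ p)%:E)%E].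
  by move=> n; have [a0 J0 tJ _] := seqP n; exact: hC.
pose b n := fine (mu (qball K (x n) (a n))).
have Boo n : mu (qball K (x n) (a n)) < +oo by exact: (stable_qball_lty hK k1 tri hst).
have b0 n : (0 < b n)%R.
  have [a0 _ _ _] := seqP n.
  by rewrite fine_gt0// Boo andbT; exact: (stable_qball_gt0 hK hst mu0).
have mG n : measurable (G n) by have [] := hG n.
have GB n : G n `<=` qball K (x n) (a n) by have [] := hG n.
have Gb n : (b n / 2)%:E <= mu (G n) by have [] := hG n.
have Goo n : mu (G n) < +oo.
  apply: le_lt_trans (Boo n); apply: le_measure; rewrite ?inE//.
  exact: measurable_qball.
have Gtest n := let: And4 _ _ _ h := hG n in h.
pose w0 := @test_weight_gt0 R X K p q sigma x a J b C seqP C0 b0.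
have sf : sigma_finite setT (weighted_series w0 mG Goo).
  exact: (test_measure_sigma_finite hK k1 tri dense_d q1 pq).
have tb : trace_bound (weighted_series w0 mG Goo).
  exists ((2 * k) `^ p)%R; first exact: powR_ge0.
  move=> g mg g0; exists (fun y => ((2 * k) `^ p)%:E * (net_pot K d sigma g y `^ p)); split.
  - apply: measurable_funeM.
    exact: (measurableT_comp (measurable_poweR p) (measurable_net_pot hK d sigma mg g0)).
  - move=> y; rewrite -poweR_EFin -poweRM ?lee_fin ?mulr_ge0 ?(ltW k0) ?net_pot_ge0//.
    have pg0 : 0 <= pot_fun K sigma g y.
      by apply: integral_ge0 => z _; rewrite mule_ge0 ?kernel_ge0 ?lee_fin.
    apply: gt0_ler_poweR.
    + by rewrite ltW// (lt_trans ltr01)// (conjugate_gt1 q1 pq).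
    + by rewrite in_itv/= leey andbT.
    + by rewrite in_itv/= leey andbT mule_ge0 ?net_pot_ge0// lee_fin mulr_ge0// ltW.
    + exact: (pot_fun_le_net_pot hK k1 tri dense_d).
  - rewrite ge0_integralZl//; last 3 first.
    + exact: (measurableT_comp (measurable_poweR p) (measurable_net_pot hK d sigma mg g0)).
    + by move=> y _; exact: poweR_ge0.
    + by rewrite lee_fin powR_ge0.
    apply: lee_wpmul2l; first by rewrite lee_fin powR_ge0.
    exact: (test_measure_test hK).
have [omega [u [e [[mes_u u0 e0 hu] [e' e'0 lo]]]]] := hyp _ _ w0 mG Goo sf tb.
have s0 := sigma_setT_neq0 hK seqP.
pose D : R := (4 * (2 * k) `^ q / (q - 1) * 2 `^ (q - 1))%R.
have D0 : (0 < D)%R.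
  by rewrite mulr_gt0 ?powR_gt0// divr_gt0 ?subr_gt0// mulr_gt0// powR_gt0// mulr_gt0.
apply: (@no_uniform_small_scale_bound R X K p q q1 pq sigma x a J b C seqP C0 b0 D e' D0 e'0).
move=> n; have [a0 _ _ _] := seqP n.
apply: (riccati_bound hK k1 tri q1 mes_u u0 e0 hu s0 a0).
  by rewrite divr_gt0// mulr_gt0 ?divr_gt0// mulr_gt0//; exact: w0.
apply: le_trans (lo n (x n) (a n) a0 (GB n)).
apply: (@le_trans _ _ ((e' * test_weight p q J b C n / a n)%:E * (b n / 2)%:E)).
  by rewrite -EFinM lee_fin le_eqVlt; apply/orP; left; apply/eqP; ring.
apply: lee_wpmul2l => //.
by rewrite lee_fin ltW// divr_gt0// mulr_gt0//; exact: w0.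
Qed.

(** The solution u for the datum K tau is a supersolution for tau itself. *)
Lemma ball_growth_of_measures :
  (forall omega : {sigma_finite_measure set (borel X) -> \bar R},
      classW K sigma p omega -> classZ K sigma q (pot_measure K omega)) ->
  ball_growth_condition K sigma q.
Proof.
move=> hyp; apply: ball_growth_criterion => w G w0 mG Goo tau sf [C C0 tb].
pose omega := with_sigma_finite sf.
have [|mpot [eps [eps0 [u [mes_u u0 hu]]]]] := hyp omega.
  exists C => g gL g0.
  have mg : measurable_fun [set: borel X] g by exact: (set_mem (sub_Lfun_mfun gL)).
  have [F [mF potF intF]] := tb g mg g0.
  apply: le_trans intF; apply: le_integral_ge0 => y _; first exact: poweR_ge0.
  exact: potF.
have pot0 y : 0 <= pot_measure K omega y.
  by apply: integral_ge0 => z _; exact: kernel_ge0.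
exists omega, u, eps; split.
  split => //; first exact: ltW.
  case: hu => N [mN N0 sN]; exists N; split => //; apply: subset_trans sN.
  by apply: subsetC => y /= ->; rewrite gee0_abs.
exists eps => // n x a a0 GB.
have tk z : (0 <= trunc_kernel K x a z)%R by rewrite ltW// trunc_kernel_gt0.
apply: (@le_trans _ _ (eps%:E * \int[omega]_z (trunc_kernel K x a z)%:E)); last first.
  rewrite leeDr//; apply: integral_ge0 => z _.
  by rewrite lee_fin mulr_ge0 ?powR_ge0.
rewrite -mulrA EFinM -muleA; apply: lee_wpmul2l; first by rewrite lee_fin ltW.
have mtk : measurable_fun [set: borel X] (fun z => (trunc_kernel K x a z)%:E).
  by apply/measurable_EFinP; exact: measurable_trunc_kernel.
have -> : \int[omega]_z (trunc_kernel K x a z)%:E = \int[tau]_z (trunc_kernel K x a z)%:E.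
  exact: eq_measure_integral.
rewrite integral_weighted_series//.
apply: le_trans (nneseries_ge_term n (f := fun n => (w n)%:E * \int[mu]_(y in G n) (trunc_kernel K x a y)%:E) _); last first.
  by move=> i; rewrite mule_ge0 ?lee_fin ?(ltW (w0 _))//; apply: integral_ge0 => z _; rewrite lee_fin.
rewrite EFinM -muleA; apply: lee_wpmul2l; first by rewrite lee_fin ltW.
rewrite -integral_cst//; apply: le_integral_ge0 => z; first by rewrite lee_fin invr_ge0 ltW.
by move=> /GB; rewrite in_qball// => xz; rewrite lee_fin /trunc_kernel max_l.
Qed.

(** The superposition has a density with respect to sigma; its q-th root f is a weight
    in the class Y, and the solution u for the datum f satisfies u^q >= eps^q f^q. *)
Lemma ball_growth_of_weights : mu `<< sigma ->
  classY K sigma p q `<=` classZ K sigma q ->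
  ball_growth_condition K sigma q.
Proof.
move=> mus YZ; apply: ball_growth_criterion => w G w0 mG Goo tau sf [C C0 tb].
have q0 : (0 < q)%R by exact: lt_trans ltr01 q1.
pose nu n := mfrestr (mG n) (Goo n).
have nus n : nu n `<< sigma.
  move/null_content_dominatesP : mus => mus; apply/null_content_dominatesP => A mA A0.
  apply/eqP; rewrite -measure_le0 -(mus A mA A0) /nu /mfrestr /mrestr /=.
  by apply: le_measure; rewrite ?inE//; exact: measurableI.
pose h n := Radon_Nikodym_SigmaFinite.f (nu n) sigma.
have h0 n z : 0 <= h n z by exact: (Radon_Nikodym_SigmaFinite.f_ge0 (nus n)).
have mh n : measurable_fun [set: borel X] (h n).
  exact: (measurable_int _ (Radon_Nikodym_SigmaFinite.f_integrable (nus n))).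
pose dens z := \sum_(n <oo) ((w n)%:E * h n z).
have wh0 n z : 0 <= (w n)%:E * h n z by rewrite mule_ge0 ?lee_fin ?(ltW (w0 n)).
have mwh n : measurable_fun [set: borel X] (fun z => (w n)%:E * h n z).
  exact: measurable_funeM.
have dens0 z : 0 <= dens z by exact: nneseries_ge0.
have mdens : measurable_fun [set: borel X] dens by exact: ge0_emeasurable_sum.
have int_dens (F : X -> \bar R) : measurable_fun [set: borel X] F -> (forall y, 0 <= F y) ->
    \int[sigma]_z (dens z * F z) = \int[tau]_z F z.
  move=> mF F0; rewrite integral_weighted_series//.
  under eq_integral do rewrite nneseriesZr_ge0//.
  rewrite integral_nneseries//; last 2 first.
  - by move=> n; apply: emeasurable_funM.
  - by move=> n z _; rewrite mule_ge0.
  apply: eq_eseriesr => n _.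
  under eq_integral do rewrite -muleA.
  rewrite ge0_integralZl//; last 3 first.
  - by apply: emeasurable_funM.
  - by move=> z _; rewrite mule_ge0.
  - by rewrite lee_fin ltW.
  congr (_ * _); under eq_integral do rewrite muleC.
  rewrite (Radon_Nikodym_SigmaFinite.change_of_variables (nus n))//. exact: ge0_integral_mrestr.
pose f z := dens z `^ q^-1.
have f0 z : 0 <= f z by exact: poweR_ge0.
have fq z : `|f z| `^ q = dens z.
  by rewrite gee0_abs// -poweRrM mulVf ?gt_eqF// poweRe1.
have [|mf [eps [eps0 [u [mes_u u0 hu]]]]] := YZ f.
  split.
  - exact: (measurableT_comp (measurable_poweR q^-1) mdens).
  - case: sf => F FT Ff.
    have : {ae sigma, forall z n, F n z -> dens z \is a fin_num}.
      apply: ae_foralln => n; have [mF Foo] := Ff n.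
      apply: (integrable_ae mF); apply/integrableP; split; first exact: measurable_funTS.
      under eq_integral do rewrite gee0_abs//.
      apply: le_lt_trans Foo.
      rewrite [X in _ <= X](_ : _ = \int[tau]_z (\1_(F n) z)%:E); last first.
        by rewrite integral_indic// setIT.
      rewrite -int_dens//; last first.
        by apply/measurable_EFinP; exact: measurable_indic.
      rewrite integral_mkcond; apply: le_integral_ge0 => z _.
        exact: erestrict_ge0.
      by rewrite patchE indicE; case: (z \in F n); rewrite ?mule1 ?mule0.
    case => N [mN N0 sN]; exists N; split => //; apply: subset_trans sN.
    apply: subsetC => z /= hz; apply: fin_num_poweR.
    have : setT z by []. rewrite FT => -[n _ Fn]; exact: hz Fn.
  - exists C => g gL g0.
    have mg : measurable_fun [set: borel X] g by exact: (set_mem (sub_Lfun_mfun gL)).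
    have [F [mF potF intF]] := tb g mg g0.
    have F0 y : 0 <= F y by apply: le_trans (potF y); exact: poweR_ge0.
    apply: le_trans intF; rewrite -int_dens//; apply: le_integral_ge0 => y _.
      by rewrite mule_ge0// poweR_ge0.
    by rewrite fq; apply: lee_wpmul2l.
exists mu, u, 0%R; split.
  split => //.
  case: hu => N [mN N0 sN]; exists N; split => //; apply: subset_trans sN.
  by apply: subsetC => y /= ->; rewrite mul0e adde0 leeDl// mule_ge0// lee_fin ltW.
exists (eps `^ q)%R; first exact: powR_gt0.
move=> n x a a0 GB.
have tk z : (0 <= trunc_kernel K x a z)%R by rewrite ltW// trunc_kernel_gt0.
rewrite /trunc_pot mul0e adde0.
have nuG : mu (G n) = \int[sigma]_(z in G n) h n z.
  rewrite -(Radon_Nikodym_SigmaFinite.f_integral (nus n) (mG n)).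
  by transitivity (mu (G n `&` G n)); first rewrite setIid.
rewrite nuG -ge0_integralZl//; last 2 first.
- exact: measurable_funTS.
- by rewrite lee_fin !mulr_ge0 ?powR_ge0 ?invr_ge0 ?(ltW a0) ?(ltW (w0 n)).
have muqt : measurable_fun [set: borel X] (fun z => (u z `^ q * trunc_kernel K x a z)%:E).
  apply/measurable_EFinP; apply: measurable_funM; last exact: measurable_trunc_kernel.
  exact: (measurableT_comp (measurable_powR q) mes_u).
apply: (@le_trans _ _ (\int[sigma]_(z in G n) (u z `^ q * trunc_kernel K x a z)%:E)); last first.
  by apply: ge0_subset_integral => // z _; rewrite lee_fin mulr_ge0 ?powR_ge0.
apply: ae_ge0_le_integral => //.
- by move=> z _; rewrite mule_ge0// lee_fin !mulr_ge0 ?powR_ge0 ?invr_ge0 ?(ltW a0) ?(ltW (w0 n)).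
- by apply: measurable_funeM; exact: measurable_funTS.
- by move=> z _; rewrite lee_fin mulr_ge0 ?powR_ge0.
- exact: measurable_funTS.
case: hu => N [mN N0 sN]; exists N; split => //; apply: subset_trans sN.
apply: subsetC => z /= uz Gz.
have uf : eps%:E * f z <= (u z)%:E.
  rewrite uz gee0_abs// leeDr//; apply: integral_ge0 => y _.
  by rewrite mule_ge0 ?kernel_ge0// lee_fin powR_ge0.
have : (eps `^ q)%:E * ((w n)%:E * h n z) <= (u z `^ q)%:E.
  apply: (@le_trans _ _ ((eps `^ q)%:E * dens z)).
    apply: lee_wpmul2l; first by rewrite lee_fin powR_ge0.
    exact: (nneseries_ge_term n (f := fun n => (w n)%:E * h n z)).
  rewrite -fq gee0_abs// -!poweR_EFin -poweRM ?lee_fin ?(ltW eps0)//.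
  apply: gt0_ler_poweR => //; first exact: ltW.
  - by rewrite in_itv/= leey andbT mule_ge0// lee_fin ltW.
  - by rewrite in_itv/= leey andbT lee_fin.
move: (GB _ Gz); rewrite in_qball// => xz.
rewrite /trunc_kernel max_l// => uh.
rewrite (mulrC _ a^-1%R) EFinM (EFinM (eps `^ q)) -!muleA.
rewrite (mulrC _ a^-1%R) EFinM; apply: lee_wpmul2l => //.
by rewrite lee_fin invr_ge0 ltW.
Qed.

End criterion.

Theorem theorem5p8 (R : realType) (X : pmetricType R) (K : X -> X -> \bar R)
    (sigma : {sigma_finite_measure set (borel X) -> \bar R}) (p q : R) :
  quasi_metric_kernel K -> 1 < q -> p^-1 + q^-1 = 1 ->
  ((exists mu : {measure set (borel X) -> \bar R},
      [/\ mu setT != 0%E, stable K mu & mu `<< sigma]) ->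
   classY K sigma p q = classZ K sigma q ->
   classZ K sigma q <> zero_class sigma ->
   ball_growth_condition K sigma q)
  /\
  (continuous_kernel K ->
   (forall (x : X) (a : R), 0 < a -> compact (qball K x a)) ->
   (exists mu : {measure set (borel X) -> \bar R},
      mu setT != 0%E /\ stable K mu) ->
   (forall omega : {sigma_finite_measure set (borel X) -> \bar R},
      classW K sigma p omega -> classZ K sigma q (pot_measure K omega)) ->
   ball_growth_condition K sigma q).
Proof.
move=> hK q1 pq; split.
  move=> [mu [mu0 hst mus]] YZ _.
  by apply: (ball_growth_of_weights hK q1 pq hst mu0 mus); rewrite YZ.
move=> _ _ [mu [mu0 hst]] hyp.
exact: (ball_growth_of_measures hK q1 pq hst mu0).
Qed.
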